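(* Let $\mathbb{K}$ be a field, $X$ a finite, faithful, indecomposable quandle, $\chi:X\times X\to\mathbb{K}^\times$ a 2-cocycle, and let $\mathfrak{B}=\mathfrak{B}(X,\chi)$ be the associated Nichols algebra; assume $\mathfrak{B}$ is finite-dimensional. Assume that the degree $\deg X$ divides the order $\operatorname{ord}\chi$ of the diagonal elements of $\chi$. (a) All $\mathrm{Inn}\,X$-homogeneous components $\mathfrak{B}(g)$, $g\in \mathrm{Inn}\,X$, have the same dimension, and thus $\#\mathrm{Inn}\,X$ divides $\dim\mathfrak{B}$. (The equality of dimensions is wrong in general without the divisibility assumption: there exist a field $\mathbb{K}$, a finite faithful indecomposable quandle $X$ and a 2-cocycle $\chi$ with $\mathfrak{B}(X,\chi)$ finite-dimensional and $\deg X\nmid \operatorname{ord}\chi$, for which the $\mathrm{Inn}\,X$-homogeneous components do not all have the same dimension.) (b) Moreover, let $X'$ be a non-empty proper subrack of $X$ and let $\mathfrak{B}'$ be the Nichols subalgebra of $\mathfrak{B}$ generated by $X'$. Assume that $X\setminus X'$ still generates $\mathrm{Inn}\,X$, i.e. $\{g_t : t\in X\setminus X'\}$ generates $\mathrm{Inn}\,X$. Then $\#\mathrm{Inn}\,X\cdot\dim\mathfrak{B}'$ divides $\dim\mathfrak{B}$.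
   Context: A rack is a set $X$ with a binary operation $\triangleright$ such that $t_1\triangleright(t_2\triangleright t_3)=(t_1\triangleright t_2)\triangleright(t_1\triangleright t_3)$ and each $g_t:X\to X$, $s\mapsto t\triangleright s$ is bijective. A quandle is a rack with $t\triangleright t=t$ for all $t$. $\mathrm{Inn}\,X$ is the permutation group generated by all $g_t$; $\mathrm{Env}\,X=\langle t\in X\mid s\cdot t=(s\triangleright t)\cdot s\ \forall s,t\in X\rangle$, of which $\mathrm{Inn}\,X$ is a quotient via $t\mapsto g_t$. $X$ is indecomposable if $\mathrm{Inn}\,X$ acts transitively on $X$, and faithful if $t\mapsto g_t$ is injective. For indecomposable $X$, $\deg X$ is the order of $g_t$ in $\mathrm{Inn}\,X$ (independent of $t$). A 2-cocycle is a map $\chi:X\times X\to\mathbb{K}^\times$ with $\chi(t,s\triangleright r)\chi(s,r)=\chi(t\triangleright s,t\triangleright r)\chi(t,r)$. For indecomposable $X$ the value $q=\chi(t,t)$ does not depend on $t$; $\operatorname{ord}\chi$ is the minimal $m\ge 1$ with $q^m=1$ (finite whenever $\mathfrak{B}$ below is finite-dimensional). Let $V$ have basis $\{e_t\}_{t\in X}$ and put $g_t(e_s)=\chi(t,s)e_{t\triangleright s}$; this defines an action of $\mathrm{Env}\,X$ on $V$. The braiding is $c(e_t\otimes w)=g_t(w)\otimes e_t$. The tensor algebra $TV$ becomes a graded braided Hopf algebra, where $\Delta:TV\to TV\otimes TV$ is the algebra map for which all elements of $V$ are primitive, and $TV\otimes TV$ has the multiplication $(\mu\otimes\mu)(\mathrm{id}\otimes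 c\otimes\mathrm{id})$ with $c$ extended to $TV$. The Nichols algebra $\mathfrak{B}=\mathfrak{B}(X,\chi)$ is $TV/I$, where $I$ is the unique maximal homogeneous ideal and coideal (i.e. $\Delta(I)\subseteq I\otimes TV+TV\otimes I$) all of whose homogeneous elements have degree $\ge 2$. $\mathfrak{B}$ is $\mathrm{Env}\,X$-graded with $e_t$ of degree $t$, hence graded by every quotient $G$ of $\mathrm{Env}\,X$, in particular by $\mathrm{Inn}\,X$; $\mathfrak{B}(g)$ denotes the homogeneous component of degree $g$. A subrack $X'\subseteq X$ is a subset which is a rack under $\triangleright$. The Nichols subalgebra generated by $X'$ is the unital subalgebra $\mathfrak{B}'$ of $\mathfrak{B}$ generated by $\{e_t:t\in X'\}$; it is the Nichols algebra of $X'$ with the restricted cocycle. *)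

(* Defs.v *)
From HB Require Import structures.
From mathcomp Require Import all_boot all_fingroup all_algebra.
From mathcomp Require Import boolp.
From mathcomp Require Import finmap monalg.

Set Implicit Arguments.
Unset Strict Implicit.
Unset Printing Implicit Defensive.

Import GRing.Theory.
Local Open Scope ring_scope.
Local Open Scope quotient_scope.

Reserved Notation "t |> s" (at level 40, left associativity).

HB.mixin Record isRack X := {
  rop : X -> X -> X;
  ropD : forall t1 t2 t3, rop t1 (rop t2 t3) = rop (rop t1 t2) (rop t1 t3);
  rop_bij : forall t, bijective (rop t)
}.

#[short(type="finRackType")]
HB.structure Definition FinRack := {X of isRack X & Finite X}.

HB.mixin Record isQuandle X of FinRack X := {
  rop_id : forall t : X, rop t t = t
}.

#[short(type="finQuandleType")]
HB.structure Definition FinQuandle := {X of isQuandle X & FinRack X}.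

Notation "t |> s" := (rop t s).

Section Racks.
Variable X : finRackType.
Implicit Types t s : X.

Definition lperm t : {perm X} := perm (bij_inj (rop_bij t)).

Definition Inn : {group {perm X}} := <<[set lperm t | t : X]>>%G.

(* The library's transitivity asks the set acted on to be an orbit, so an     *)
(* indecomposable rack is nonempty.                                           *)
Definition indecomposable := [transitive Inn, on [set: X] | 'P].

Definition faithful_rack := injective lperm.

Definition rack_deg (d : nat) := forall t, #[lperm t]%g = d.

(* Injectivity of the restriction of rop t is inherited, so this says that    *)
(* rop t restricts to a bijection of X'.                                      *)
Definition subrack (X' : {set X}) :=
  {in X', forall t, [set t |> s | s in X'] = X'}.

End Racks.

Arguments Inn X : clear implicits.
Arguments indecomposable X : clear implicits.
Arguments faithful_rack X : clear implicits.
Arguments rack_deg X d : clear implicits.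

Definition cocycle2 (K : fieldType) (X : finRackType) (chi : X -> X -> K) :=
  (forall t s, chi t s != 0) /\
  (forall t s r, chi t (s |> r) * chi s r = chi (t |> s) (t |> r) * chi t r).

Definition cocycle_ord (K : fieldType) (X : finRackType) (chi : X -> X -> K)
  (m : nat) := forall t, m.-primitive_root (chi t t).

Lemma rack_degP (X : finRackType) :
  indecomposable X -> exists! d, rack_deg X d.
Proof.
move=> trX.
have lpermJ t s : (lperm s ^ lperm t)%g = lperm (t |> s).
  apply/permP=> x; rewrite -(permKV (lperm t) x) permJ !permE.
  exact: ropD.
have degJ g t : g \in Inn X -> #[lperm (g t)]%g = #[lperm t]%g.
  move=> /gen_prodgP[n [c cX ->]]; elim: n c cX => [|n IHn] c cX.
    by rewrite big_ord0 perm1.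
  rewrite big_ord_recr permM.
  have /imsetP[s _ ->] := cX ord_max.
  by rewrite [X in lperm X]permE -lpermJ orderJ IHn.
have /imsetP[t0 _ defX] := trX.
exists #[lperm t0]%g; split=> [t|d /(_ t0)//].
have: t \in [set: X] by rewrite inE.
by rewrite defX => /imsetP[g gX ->]; rewrite degJ.
Qed.

Lemma cocycle_diag (K : fieldType) (X : finQuandleType) (chi : X -> X -> K) :
  indecomposable X -> cocycle2 chi -> forall t s, chi t t = chi s s.
Proof.
move=> trX [nz cc].
have diag1 t s : chi (t |> s) (t |> s) = chi s s.
  by have := cc t s s; rewrite rop_id [RHS]mulrC => /(mulfI (nz t s)) ->.
have diag g t : g \in Inn X -> chi (g t) (g t) = chi t t.
  move=> /gen_prodgP[n [c cX ->]]; elim: n c cX => [|n IHn] c cX.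
    by rewrite big_ord0 perm1.
  rewrite big_ord_recr permM.
  have /imsetP[s _ ->] := cX ord_max.
  by rewrite [lperm s _]permE diag1 IHn.
have /imsetP[t0 _ defX] := trX.
suff dg t : chi t t = chi t0 t0 by move=> t s; rewrite !dg.
have: t \in [set: X] by rewrite inE.
by rewrite defX => /imsetP[g gX ->]; rewrite diag.
Qed.

(* Permutations multiply on the right in {perm X} (p * q applies p first), so *)
(* this is the composite of lperm t_1, ..., lperm t_n in which lperm t_n is   *)
(* applied first, i.e. the image of t_1 ... t_n under the morphism from the   *)
(* enveloping group to the group of permutations under composition.           *)
Definition word_deg (X : finRackType) (w : seq X) : {perm X} :=
  foldr (fun t p => p * lperm t)%g 1%g w.

Definition word (X : finRackType) := seq X.
HB.instance Definition _ (X : finRackType) := Choice.on (word X).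

Lemma cat_conical (X : finRackType) (u v : word X) :
  u ++ v = [::] -> u = [::] /\ v = [::].
Proof. by case: u. Qed.

HB.instance Definition _ (X : finRackType) :=
  Choice_isMonomialDef.Build (word X) (@catA X) (@cat0s X) (@cats0 X)
    (@cat_conical X).

Section NicholsIdeal.
Variables (K : fieldType) (X : finRackType) (chi : X -> X -> K).

(* The free monoid algebra on X, i.e. the tensor algebra of the space with    *)
(* basis X; the pairs of words are a basis of its tensor square.              *)
Local Notation TV := {malg K[word X]}.
Local Notation TVTV := {malg K[(word X * word X)%type]}.

Definition lin_ext (I : choiceType) (W : lmodType K) (F : I -> W)
  (x : {malg K[I]}) : W := \sum_(i <- msupp x) x@_i *: F i.

Definition wmon (w : word X) : TV := << w >>.

Definition tens (x y : TV) : TVTV :=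
  lin_ext (fun u => lin_ext (fun v => << (u, v) >>) y) x.

Definition gact (t : X) : TV -> TV :=
  lin_ext (fun w : word X =>
    (\prod_(s <- w) chi t s) *: wmon [seq t |> s | s <- w]).

Definition word_act (v : word X) (x : TV) : TV := foldr gact x v.

(* (a (x) v) (u (x) b) = a (v . u) (x) v b, since c (v (x) u) = (v . u) (x) v *)
(* for a word v acting on TV through the enveloping group.                    *)
Definition braided_mul (P Q : TVTV) : TVTV :=
  lin_ext (fun p => lin_ext (fun q =>
    tens (wmon p.1 * word_act p.2 (wmon q.1)) (wmon p.2 * wmon q.2)) Q) P.

Definition tgen (t : X) : TV := wmon [:: t].

(* Since X generates TV, this recursion determines the algebra map for which  *)
(* the tgen t are primitive.                                                  *)
Definition coprod_word (w : word X) : TVTV :=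
  foldr (fun t D => braided_mul (tens (tgen t) 1 + tens 1 (tgen t)) D)
    (tens 1 1) w.

Definition coprod : TV -> TVTV := lin_ext coprod_word.

Definition hcomp (n : nat) : TV -> TV :=
  lin_ext (fun w : word X => if size w == n then wmon w else 0).

Definition ideal_set (J : TV -> Prop) :=
  [/\ J 0, forall x y, J x -> J y -> J (x + y)
    & forall a x, J x -> J (a * x) /\ J (x * a)].

Definition homogeneous_set (J : TV -> Prop) :=
  forall x n, J x -> J (hcomp n x).

(* A finite sum of p.1 (x) p.2 with p.1 or p.2 in J is an element of          *)
(* J (x) TV + TV (x) J.                                                       *)
Definition coideal_set (J : TV -> Prop) :=
  forall x, J x -> exists2 s : seq (TV * TV),
    coprod x = \sum_(p <- s) tens p.1 p.2
    & forall p, p \in s -> J p.1 \/ J p.2.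

(* The fixed points of hcomp n are the homogeneous elements of degree n.      *)
Definition high_degree (J : TV -> Prop) :=
  forall x n, J x -> hcomp n x = x -> x != 0 -> (2 <= n)%N.

Definition nichols_admissible (J : TV -> Prop) :=
  [/\ ideal_set J, homogeneous_set J, coideal_set J & high_degree J].

(* By nichols_ideal_admissible and nichols_ideal_max below, the union of all  *)
(* admissible sets is the greatest one.                                       *)
Definition nichols_ideal (x : TV) : Prop :=
  exists2 J, nichols_admissible J & J x.

Lemma lin_ext_linear (I : choiceType) (W : lmodType K) (F : I -> W) :
  linear (lin_ext F).
Proof.
have ext (d : {fset I}) (x : {malg K[I]}) : (msupp x `<=` d)%fset ->
    lin_ext F x = \sum_(i <- d) x@_i *: F i.
  move=> sxd; rewrite /lin_ext; apply: big_fset_incl => // i _ ix.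
  by rewrite mcoeff_outdom // scale0r.
move=> a x y; set d := (msupp x `|` msupp y `|` msupp (a *: x + y))%fset.
rewrite !(ext d) ?scaler_sumr -?big_split /=; last 3 first.
- by rewrite /d fsubsetU // fsubsetU // fsubset_refl ?orbT.
- by rewrite /d fsubsetU // fsubsetU // fsubset_refl ?orbT.
- by rewrite /d fsubsetU // fsubset_refl ?orbT.
by apply: eq_bigr => i _; rewrite mcoeffD mcoeffZ scalerDl scalerA.
Qed.

HB.instance Definition _ (I : choiceType) (W : lmodType K) (F : I -> W) :=
  GRing.isLinear.Build K {malg K[I]} W *:%R (lin_ext F) (lin_ext_linear F).

Lemma nichols_admissibleD (J1 J2 : TV -> Prop) :
  nichols_admissible J1 -> nichols_admissible J2 ->
  nichols_admissible (fun z => exists x y, [/\ J1 x, J2 y & z = x + y]).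
Proof.
move=> [[z1 D1 M1] h1 c1 d1] [[z2 D2 M2] h2 c2 d2]; split.
- split; first by exists 0, 0; rewrite addr0.
    move=> _ _ [x [y [Jx Jy ->]]] [x' [y' [Jx' Jy' ->]]].
    by exists (x + x'), (y + y'); split; [exact: D1|exact: D2|rewrite addrACA].
  move=> a _ [x [y [Jx Jy ->]]].
  have [lx rx] := M1 a x Jx; have [ly ry] := M2 a y Jy.
  split; first by exists (a * x), (a * y); rewrite mulrDr.
  by exists (x * a), (y * a); rewrite mulrDl.
- move=> _ n [x [y [Jx Jy ->]]]; exists (hcomp n x), (hcomp n y).
  by split; [exact: h1|exact: h2|exact: linearD].
- move=> _ [x [y [Jx Jy ->]]].
  have [s1 e1 j1] := c1 x Jx; have [s2 e2 j2] := c2 y Jy.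
  exists (s1 ++ s2); first by rewrite big_cat -e1 -e2; exact: linearD.
  move=> p; rewrite mem_cat => /orP[/j1|/j2] [] Jp; [left|right|left|right].
  + by exists p.1, 0; rewrite addr0.
  + by exists p.2, 0; rewrite addr0.
  + by exists 0, p.1; rewrite add0r.
  + by exists 0, p.2; rewrite add0r.
- have hcompK n x : hcomp n (hcomp n x) = hcomp n x.
    have hE : hcomp n x =
      \sum_(w <- msupp x) x@_w *: (if size w == n then wmon w else 0) by [].
    rewrite hE {1}/hcomp linear_sum; apply: eq_bigr => w _.
    rewrite linearZ /=; congr (_ *: _); case: ifP => // sw; last exact: linear0.
    by rewrite /lin_ext /wmon msuppU oner_eq0 big_seq_fset1 mcoeffUU scale1r sw.
  move=> _ n [x [y [Jx Jy ->]]] hxy nz.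
  have exy : hcomp n x + hcomp n y = x + y.
    by rewrite -[RHS]hxy; apply/esym/linearD.
  have [x0|nzx] := eqVneq (hcomp n x) 0; last first.
    exact: d1 (h1 _ n Jx) (hcompK n x) nzx.
  apply: d2 (h2 _ n Jy) (hcompK n y) _.
  by apply: contraNneq nz => y0; rewrite -exy x0 y0 addr0.
Qed.

Lemma nichols_admissible0 : nichols_admissible (fun z => z = 0).
Proof.
split.
- split=> // [x y -> ->|a x ->]; first by rewrite addr0.
  by rewrite mulr0 mul0r.
- by move=> x n ->; exact: linear0.
- move=> x ->; exists [::]; first by rewrite big_nil; exact: linear0.
  by [].
- by move=> x n -> _; rewrite eqxx.
Qed.

Lemma nichols_ideal_max (J : TV -> Prop) :
  nichols_admissible J -> forall x, J x -> nichols_ideal x.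
Proof. by move=> admJ x Jx; exists J. Qed.

Lemma nichols_ideal_admissible : nichols_admissible nichols_ideal.
Proof.
split.
- split; first by exists (fun z => z = 0) => //; exact: nichols_admissible0.
    move=> x y [J1 a1 J1x] [J2 a2 J2y].
    by eexists; [exact: nichols_admissibleD a1 a2|exists x, y].
  move=> a x [J aJ Jx]; have [[_ _ M] _ _ _] := aJ.
  by have [? ?] := M a x Jx; split; exists J.
- by move=> x n [J aJ Jx]; exists J => //; case: aJ => _ h _ _; exact: h.
- move=> x [J aJ Jx]; have [_ _ c _] := aJ; have [s es js] := c x Jx.
  by exists s => // p /js[] Jp; [left|right]; exists J.
- by move=> x n [J [_ _ _ d] Jx]; exact: d Jx.
Qed.

Definition nichols_pred : {pred TV} := fun x => `[< nichols_ideal x >].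

Lemma nichols_predP x : reflect (nichols_ideal x) (x \in nichols_pred).
Proof. exact: asboolP. Qed.

Lemma nichols_predMl a x : x \in nichols_pred -> a * x \in nichols_pred.
Proof.
have [[_ _ M] _ _ _] := nichols_ideal_admissible.
by move=> /nichols_predP Ix; apply/nichols_predP; case: (M a x Ix).
Qed.

Lemma nichols_predMr a x : x \in nichols_pred -> x * a \in nichols_pred.
Proof.
have [[_ _ M] _ _ _] := nichols_ideal_admissible.
by move=> /nichols_predP Ix; apply/nichols_predP; case: (M a x Ix).
Qed.

Lemma nichols_pred1 : 1 \notin nichols_pred.
Proof.
apply/negP => /nichols_predP I1.
have [_ _ _ d] := nichols_ideal_admissible.
suff: (2 <= 0)%N by [].
apply: (d 1 0%N I1) (oner_neq0 _).
rewrite /hcomp /lin_ext (_ : 1 = << [::] : word X >>) //.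
by rewrite msuppU oner_eq0 big_seq_fset1 mcoeffUU scale1r.
Qed.

Lemma nichols_zmod_closed : zmod_closed nichols_pred.
Proof.
have [[z D M] _ _ _] := nichols_ideal_admissible.
split; first exact/nichols_predP.
move=> x y /nichols_predP Ix Iy; apply/nichols_predP; apply: D => //.
by apply/nichols_predP; rewrite -mulN1r; exact: nichols_predMl.
Qed.

HB.instance Definition _ :=
  GRing.isZmodClosed.Build TV nichols_pred nichols_zmod_closed.

Definition nichols := {ideal_quot nichols_pred}.

HB.instance Definition _ := GRing.Zmodule.on nichols.

(* fingroup has a repr of its own. *)
Local Notation repr := generic_quotient.repr.

Definition nproj (x : TV) : nichols := \pi_nichols x.
Definition nmul (x y : nichols) : nichols := nproj (repr x * repr y).
Definition nscale (a : K) (x : nichols) : nichols := nproj (a *: repr x).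

Lemma nproj_eq x y : (nproj x = nproj y) <-> (x - y \in nichols_pred).
Proof.
rewrite (Quotient.idealrBE nichols_pred).
by split=> [/eqP|/eqP].
Qed.

Lemma nprojD x y : nproj (x + y) = nproj x + nproj y.
Proof. by rewrite /nproj raddfD. Qed.

Lemma nreprK x : nproj (repr x) = x. Proof. exact: generic_quotient.reprK. Qed.

Lemma nprojM x y : nproj (x * y) = nmul (nproj x) (nproj y).
Proof.
apply/nproj_eq; set x' := repr _; set y' := repr _.
have hx : x - x' \in nichols_pred by apply/nproj_eq; rewrite nreprK.
have hy : y - y' \in nichols_pred by apply/nproj_eq; rewrite nreprK.
rewrite (_ : x * y - x' * y' = (x - x') * y + x' * (y - y')); last first.
  by rewrite mulrBl mulrBr addrA subrK.
by apply: rpredD; [exact: nichols_predMr|exact: nichols_predMl].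
Qed.

Lemma nprojZ a x : nproj (a *: x) = nscale a (nproj x).
Proof.
apply/nproj_eq; rewrite -scalerBr -mul_malgC; apply: nichols_predMl.
by apply/nproj_eq; rewrite nreprK.
Qed.

Lemma nmulA : associative nmul.
Proof.
move=> x y z; rewrite -[x]nreprK -[y]nreprK -[z]nreprK.
by rewrite -!nprojM mulrA.
Qed.

Lemma nmul1x : left_id (nproj 1) nmul.
Proof. by move=> x; rewrite -[x]nreprK -nprojM mul1r. Qed.

Lemma nmulx1 : right_id (nproj 1) nmul.
Proof. by move=> x; rewrite -[x]nreprK -nprojM mulr1. Qed.

Lemma nmulDl : left_distributive nmul +%R.
Proof.
move=> x y z; rewrite -[x]nreprK -[y]nreprK -[z]nreprK.
by rewrite -nprojD -!nprojM -nprojD mulrDl.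
Qed.

Lemma nmulDr : right_distributive nmul +%R.
Proof.
move=> x y z; rewrite -[x]nreprK -[y]nreprK -[z]nreprK.
by rewrite -nprojD -!nprojM -nprojD mulrDr.
Qed.

Lemma nichols_1_neq0 : nproj 1 != 0.
Proof.
apply: contraNneq nichols_pred1; rewrite -[0]nreprK => /nproj_eq.
have /nproj_eq : nproj (repr (0 : nichols)) = nproj 0.
  by rewrite nreprK /nproj raddf0.
by rewrite subr0 => I0 /rpredD/(_ I0); rewrite subrK.
Qed.

HB.instance Definition _ := GRing.Zmodule_isNzRing.Build nichols
  nmulA nmul1x nmulx1 nmulDl nmulDr nichols_1_neq0.

Lemma nscaleA a b x : nscale a (nscale b x) = nscale (a * b) x.
Proof. by rewrite -[x]nreprK -!nprojZ scalerA. Qed.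

Lemma nscale1x : left_id 1 nscale.
Proof. by move=> x; rewrite -[x]nreprK -nprojZ scale1r. Qed.

Lemma nscaleDr : right_distributive nscale +%R.
Proof.
move=> a x y; rewrite -[x]nreprK -[y]nreprK.
by rewrite -nprojD -!nprojZ -nprojD scalerDr.
Qed.

Lemma nscaleDl x : {morph nscale^~ x : a b / a + b}.
Proof. by move=> a b; rewrite -[x]nreprK -!nprojZ -nprojD scalerDl. Qed.

HB.instance Definition _ := GRing.Zmodule_isLmodule.Build K nichols
  nscaleA nscale1x nscaleDr nscaleDl.

Lemma nscaleAl (a : K) (x y : nichols) : a *: (x * y) = (a *: x) * y.
Proof.
change (nscale a (nmul x y) = nmul (nscale a x) y).
by rewrite -[x]nreprK -[y]nreprK -!(nprojM, nprojZ) -scalerAl.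
Qed.

HB.instance Definition _ := GRing.Lmodule_isLalgebra.Build K nichols nscaleAl.

Lemma malg_scalerAr (a : K) (x y : TV) : a *: (x * y) = x * (a *: y).
Proof.
rewrite -![a *: _]mul_malgC !mulrA; congr (_ * y).
rewrite mul_malgC malgZ_def malgM_def fgmulgU; apply: eq_bigr => u _.
by rewrite mulrC mulm1.
Qed.

Lemma nscaleAr (a : K) (x y : nichols) : a *: (x * y) = x * (a *: y).
Proof.
change (nscale a (nmul x y) = nmul x (nscale a y)).
by rewrite -[x]nreprK -[y]nreprK -!(nprojM, nprojZ) malg_scalerAr.
Qed.

HB.instance Definition _ := GRing.Lalgebra_isAlgebra.Build K nichols nscaleAr.

Definition ngen (t : X) : nichols := nproj (tgen t).

(* The image in TV/I of the span of the words of degree g.                    *)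
Definition ncomp (g : {perm X}) (b : nichols) : Prop :=
  exists2 x : TV, forall w, w \in msupp x -> word_deg w = g & b = nproj x.

(* The least unital subalgebra containing the ngen t with t in X'.            *)
Definition nsub (X' : {set X}) (b : nichols) : Prop :=
  forall A : {pred nichols}, GRing.subalg_closed A ->
    (forall t, t \in X' -> ngen t \in A) -> b \in A.

End NicholsIdeal.

Arguments ncomp [K X] chi g b.
Arguments nsub [K X] chi X' b.

(* Meant for a predicate U that defines a linear subspace of V.               *)
Definition has_dim (K : fieldType) (V : lmodType K) (U : V -> Prop) (n : nat) :=
  exists b : 'I_n -> V,
    [/\ forall i, U (b i),
        forall c : 'I_n -> K, \sum_i c i *: b i = 0 -> forall i, c i = 0
      & forall v, U v -> exists c : 'I_n -> K, v = \sum_i c i *: b i].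

(* Main.v *)
From HB Require Import structures.
Require Import Defs.
From mathcomp Require Import all_boot all_fingroup all_algebra.
From mathcomp Require Import cyclic.
From mathcomp Require Import boolp.
From mathcomp Require Import finmap monalg.

(** The relations of a Nichols algebra are known only as the greatest
    admissible ideal, so everything rests on a handier description of it by
    derivations.  The component of the coproduct in TV (x) V defines for each
    t a skew derivation D_t of the tensor algebra, with
    D_t (x y) = x D_t y + D_t x (t . y) and D_t e_s = [s = t], and the
    defining ideal consists of the x such that all iterated derivations
    D_t1 ... D_tn x have constant term 0 (nichols_idealP).  Hence the
    derivations live on the Nichols algebra B, where they separate points:
    an element killed by all these functionals is 0 (nichols_sep).  The same
    holds for the derivations L_t on the left side, which commute with the
    D_s.

    Let B' be the subalgebra generated by a subrack X', and let C be the
    intersection of the kernels of the D_s with s in X'.  Two facts give the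
    divisibility; X' empty yields B' = K and C = B, which is part (a).

    - dim B = dim C * dim B' (hopf_module_dim).  One filters B by the
      subspaces F_n killed by all products of n derivations with letters in
      X'.  Products of n such derivations map F_(n+1) to C.  A linear
      combination f of them is 0 on B as soon as its constant term vanishes on
      the part of F_(n+1) in B', because f commutes with the L_t and the
      letters outside X' are never removed (op_det).  Therefore f ranges over a
      space dual to the quotient of the n-th step in B', and a dual basis
      identifies F_(n+1) / F_n with C tensored with that quotient.

    - All homogeneous components of C have the same dimension (invs_equidim).
      For t outside X' the left multiplication by e_t and L_t preserve C, and
      satisfy L_t e_t = 1 + q e_t L_t where q has order m.  Moreover the m-th
      power of L_t is 0.  If m > 1, each element of C is thus uniquely the sum
      of the e_t^i v_i with i < m and L_t v_i = 0, so that the dimension of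
      the component of degree g is the sum over i < m of the dimensions of the
      kernel of L_t in degree t^-i g.  As the order of g_t divides m, this sum
      is the same for t g as for g (qweyl_has_dim).  The g_t with t outside X'
      generate Inn X.

    Without the divisibility the equality fails for the quandle of four
    elements on the 3-cycles of the alternating group A_4 with the constant
    cocycle 1 over the field with two elements, where deg X = 3 and the order
    of q is 1.  There B is spanned by 36 words; of these only two have the
    degree of a certain double transposition (ncomp_small), whereas the unit
    and two words of length 3 are independent in the component of the
    identity (ncomp_large).  All verifications in this algebra amount to
    computing iterated derivations of words. *)

Set Implicit Arguments.
Unset Strict Implicit.
Unset Printing Implicit Defensive.

Import GRing.Theory.
Local Open Scope ring_scope.

(** * Dimensions of subspaces *)

Section Dimension.
Variables (K : fieldType).
Implicit Types V W : lmodType K.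

(** Linearity is a hypothesis on plain functions throughout, as the operators
    are often composites or given by an abstract property; this passes to
    bundled linear maps. *)
Lemma linear_fun V W (f : V -> W) :
  linear f -> exists F : {linear V -> W}, f = F.
Proof.
move=> lf.
pose linf := GRing.isLinear.Build K V W *:%R f lf.
by exists (HB.pack_for {linear V -> W} f linf).
Qed.

Section LinearFacts.
Variables (V W : lmodType K) (f : V -> W).
Hypothesis lf : linear f.

Lemma lin0 : f 0 = 0.
Proof. by have [F ->] := linear_fun lf; rewrite linear0. Qed.

Lemma linD x y : f (x + y) = f x + f y.
Proof. by have [F ->] := linear_fun lf; rewrite linearD. Qed.

Lemma linB x y : f (x - y) = f x - f y.
Proof. by have [F ->] := linear_fun lf; rewrite linearB. Qed.

Lemma linZ a x : f (a *: x) = a *: f x.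
Proof. by have [F ->] := linear_fun lf; rewrite linearZ. Qed.

Lemma lin_sum (I : Type) (r : seq I) (P : pred I) (E : I -> V) :
  f (\sum_(i <- r | P i) E i) = \sum_(i <- r | P i) f (E i).
Proof. by have [F ->] := linear_fun lf; rewrite linear_sum. Qed.

End LinearFacts.

Lemma linear_iter V (f : V -> V) n : linear f -> linear (iter n f).
Proof.
by move=> lf; elim: n => //= n IHn a u v; have /= -> := IHn a u v; rewrite lf.
Qed.

Definition subspace V (U : V -> Prop) :=
  U 0 /\ forall a u v, U u -> U v -> U (a *: u + v).

Lemma subspaceZ V (U : V -> Prop) a u : subspace U -> U u -> U (a *: u).
Proof. by case=> U0 UD Uu; rewrite -[_ *: _]addr0; exact: UD. Qed.

Lemma subspaceD V (U : V -> Prop) u v :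
  subspace U -> U u -> U v -> U (u + v).
Proof. by case=> U0 UD Uu Uv; rewrite -[u]scale1r; exact: UD. Qed.

Lemma subspace_sum V (U : V -> Prop) (I : Type) (r : seq I) (P : pred I) F :
  subspace U -> (forall i, P i -> U (F i)) -> U (\sum_(i <- r | P i) F i).
Proof.
move=> sU UF; elim/big_rec: _ => [|i x Pi Ux]; first by case: sU.
by apply: subspaceD => //; exact: UF.
Qed.

(** Letting an arbitrary finite type index the basis spares the bijections
    with ordinals when bases are glued together. *)
Definition basis (I : finType) V (U : V -> Prop) (b : I -> V) :=
  [/\ forall i, U (b i),
      forall c : I -> K, \sum_i c i *: b i = 0 -> forall i, c i = 0
    & forall v, U v -> exists c : I -> K, v = \sum_i c i *: b i].

Lemma basis_has_dim (I : finType) V (U : V -> Prop) (b : I -> V) :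
  basis U b -> has_dim U #|I|.
Proof.
case=> Ub bfree bspan; exists (b \o enum_val); split=> [i|c c0 i|v Uv].
- exact: Ub.
- rewrite -[i]enum_valK; pose c' := c \o (@enum_rank I).
  apply: (bfree c'); rewrite -[RHS]c0 (reindex (@enum_val I I)) /=.
    by apply: eq_bigr => j _; rewrite /c' /= enum_valK.
  by apply: onW_bij; exact: enum_val_bij.
- have [c ->] := bspan v Uv; exists (c \o enum_val).
  rewrite (reindex (@enum_val I I)) //=.
  by apply: onW_bij; exact: enum_val_bij.
Qed.

Lemma has_dim_ext V (U U' : V -> Prop) n :
  (forall v, U v <-> U' v) -> has_dim U n -> has_dim U' n.
Proof.
move=> UU' [b [Ub bfree bspan]]; exists b; split=> // [i|v /UU'].
  by apply/UU'.
exact: bspan.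
Qed.

(** More than n combinations of n vectors are dependent, since a matrix with
    more rows than columns has a nonzero left kernel. *)
Lemma free_le_span V n k (b : 'I_n -> V) (e : 'I_k -> V) :
  (forall i, exists c : 'I_n -> K, e i = \sum_j c j *: b j) ->
  (forall c : 'I_k -> K, \sum_i c i *: e i = 0 -> forall i, c i = 0) ->
  (k <= n)%N.
Proof.
move=> /choice [M eM] efree; rewrite leqNgt; apply/negP => ltnk.
pose A : 'M[K]_(k, n) := \matrix_(i, j) M i j.
have: kermx A != 0.
  by rewrite kermx_eq0 /row_free neq_ltn (leq_ltn_trans (rank_leq_col A)).
case/rowV0Pn => v /sub_kermxP vA0 /rV0Pn[i0 /negP]; apply; apply/eqP.
apply: (efree (v 0)).
under eq_bigr => i _ do rewrite eM scaler_sumr.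
rewrite exchange_big; apply: big1 => j _ /=.
rewrite (eq_bigr (fun i => (v 0 i * A i j) *: b j)) => [|i _].
  rewrite -scaler_suml (_ : \sum_i _ = (v *m A) 0 j) ?vA0 ?mxE ?scale0r //.
  by have := congr1 (fun u : 'rV_n => u 0 j) vA0; rewrite !mxE.
by rewrite scalerA mxE.
Qed.

Lemma has_dim_uniq V (U : V -> Prop) n k :
  has_dim U n -> has_dim U k -> n = k.
Proof.
move=> [b [Ub bf bs]] [e [Ue ef es]]; apply/eqP; rewrite eqn_leq.
apply/andP; split; [apply: (free_le_span (b := e) (e := b)) => // i; exact: es|].
by apply: (free_le_span (b := b) (e := e)) => // i; exact: bs.
Qed.

(** Here U need not contain the spanning family b.  A maximal free family in U
    is a basis, and its size is bounded by that of b. *)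
Lemma has_dim_span V (U : V -> Prop) n (b : 'I_n -> V) :
  subspace U ->
  (forall v, U v -> exists c : 'I_n -> K, v = \sum_i c i *: b i) ->
  exists2 k, (k <= n)%N & has_dim U k.
Proof.
move=> sU bs.
pose P k := exists e : 'I_k -> V, (forall i, U (e i)) /\
  (forall c : 'I_k -> K, \sum_i c i *: e i = 0 -> forall i, c i = 0).
have exP : exists k, `[< P k >].
  exists 0%N; apply/asboolP; exists (fun=> 0).
  by split=> [i|c _ i]; [case: sU|case: i].
have leP k : `[< P k >] -> (k <= n)%N.
  move=> /asboolP[e [Ue ef]].
  by apply: (free_le_span (b := b) (e := e)) => // i; exact: bs.
case: (ex_maxnP exP leP) => k Pk maxk; exists k; first exact: leP.
case/asboolP: Pk => e [Ue ef].
exists e; split=> // v Uv; apply: contrapT => nv.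
suff /asboolP/maxk : P k.+1 by rewrite ltnn.
pose e' (i : 'I_k.+1) := oapp e v (insub (val i)).
have e'l i : e' (widen_ord (leqnSn k) i) = e i by rewrite /e' /= valK.
have e'r : e' ord_max = v by rewrite /e' insubF //= ltnn.
have e'S c : \sum_i c i *: e' i =
    \sum_i c (widen_ord (leqnSn k) i) *: e i + c ord_max *: v.
  rewrite big_ord_recr /= e'r; congr (_ + _).
  by apply: eq_bigr => i _; rewrite e'l.
exists e'; split=> [i|c].
  by rewrite /e'; case: insub => [j|] /=; [exact: Ue|].
rewrite e'S => c0.
have cm0 : c ord_max = 0.
  apply: contrapT => /eqP cm; apply: nv.
  exists (fun i => - (c ord_max)^-1 * c (widen_ord (leqnSn k) i)).
  under eq_bigr => i _ do rewrite -scalerA.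
  rewrite -scaler_sumr; move/eqP: c0; rewrite addr_eq0 => /eqP ->.
  by rewrite scaleNr scalerN opprK scalerA mulVf // scale1r.
move: c0; rewrite cm0 scale0r addr0 => /ef cw i.
case: (unliftP ord_max i) => [j|] -> //.
by rewrite (_ : lift _ _ = widen_ord (leqnSn k) j) ?cw //; apply/val_inj/lift_max.
Qed.

Lemma has_dim_sub V (U U' : V -> Prop) n :
  has_dim U n -> subspace U' -> (forall v, U' v -> U v) ->
  exists k, has_dim U' k.
Proof.
move=> [b [_ _ bs]] sU' UU'.
by have [|k _] := has_dim_span (b := b) sU'; [move=> v /UU'/bs|exists k].
Qed.

(** Rank-nullity: a basis of the kernel together with preimages of a basis of
    the image is a basis. *)
Lemma has_dim_rank V W (U : V -> Prop) (f : V -> W) k r :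
  linear f -> subspace U ->
  has_dim (fun v => U v /\ f v = 0) k ->
  has_dim (fun w => exists2 v, U v & f v = w) r ->
  has_dim U (k + r).
Proof.
move=> lf sU [b [Ub bf bs]] [e [Ue ef es]].
have [F fF] := linear_fun lf; have fE v : f v = F v by rewrite fF.
have {Ue} /choice[e' e'P] i : exists v, U v /\ f v = e i.
  by have [v] := Ue i; exists v.
pose B (i : 'I_k + 'I_r) := match i with inl i => b i | inr j => e' j end.
have BE c : \sum_i c i *: B i =
    \sum_i c (inl i) *: b i + \sum_j c (inr j) *: e' j by rewrite big_sumType.
have FB c : f (\sum_i c i *: B i) = \sum_j c (inr j) *: e j.
  rewrite BE fE linearD !linear_sum /= big1 ?add0r => [|i _].
    by apply: eq_bigr => j _; rewrite linearZ /= -fE (e'P j).2.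
  by rewrite linearZ /= -fE (Ub i).2 scaler0.
have -> : (k + r)%N = #|{: 'I_k + 'I_r}| by rewrite card_sum !card_ord.
apply: (@basis_has_dim _ _ _ B); split.
- by case=> i; [exact: (Ub i).1|exact: (e'P i).1].
- move=> c c0; have cr j : c (inr j) = 0.
    by apply: (ef (fun j => c (inr j))); rewrite -FB c0 fE linear0.
  move: c0; rewrite BE [X in _ + X]big1 ?addr0 => [cl|j _]; last first.
    by rewrite cr scale0r.
  by case=> // i; exact: (bf (fun i => c (inl i))).
- move=> v Uv; have [|c cE] := es (f v); first by exists v.
  pose u := v - \sum_j c j *: e' j.
  have [|d dE] := bs u.
    split.
      rewrite /u -scaleN1r addrC; apply: sU.2 => //.
      apply: subspace_sum => // j _; apply: subspaceZ => //; exact: (e'P j).1.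
    rewrite fE linearB -fE cE linear_sum -sumrB big1 //= => j _.
    by rewrite linearZ /= -fE (e'P j).2 subrr.
  exists (fun i => match i with inl i => d i | inr j => c j end).
  by rewrite BE -dE subrK.
Qed.

Lemma has_dim0 V : has_dim (fun v : V => v = 0) 0.
Proof.
exists (fun=> 0); split=> // [c _ []//|v ->].
by exists (fun=> 0); rewrite big_ord0.
Qed.

Lemma has_dim_ffun V (U : V -> Prop) (I : finType) n :
  subspace U -> has_dim U n ->
  has_dim (fun w : {ffun I -> V} => forall i, U (w i)) (#|I| * n).
Proof.
move=> sU [b [Ub bf bs]].
have -> : (#|I| * n)%N = #|{: I * 'I_n}| by rewrite card_prod card_ord.
pose B (ij : I * 'I_n) : {ffun I -> V} :=
  [ffun i => if i == ij.1 then b ij.2 else 0].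
have BE c i : (\sum_ij c ij *: B ij) i = \sum_j c (i, j) *: b j.
  transitivity (\sum_i' \sum_j (c (i', j) *: B (i', j)) i).
    by rewrite sum_ffunE pair_bigA; apply: eq_bigr => -[].
  rewrite (bigD1 i) //= [X in _ + X]big1 ?addr0 => [|i' /negPf ni].
    by apply: eq_bigr => j _; rewrite !ffunE eqxx.
  by rewrite big1 // => j _; rewrite !ffunE eq_sym ni scaler0.
apply: (@basis_has_dim _ _ _ B); split.
- by move=> [i j] i'; rewrite ffunE; case: ifP => _; [exact: Ub|case: sU].
- move=> c c0 [i j]; apply: (bf (fun j => c (i, j))).
  by rewrite -BE c0 ffunE.
- move=> w Uw; have /choice[c cE] i : exists c : 'I_n -> K, w i = \sum_j c j *: b j.
    exact: bs.
  by exists (fun ij => c ij.1 ij.2); apply/ffunP => i; rewrite BE cE.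
Qed.

(** The projections make the sum of the pieces direct, so that bases of the
    pieces form a basis. *)
Lemma has_dim_graded V (U : V -> Prop) (I : finType) (P : {set I})
    (pr : I -> V -> V) n :
  subspace U -> (forall i, linear (pr i)) -> (forall i v, U v -> U (pr i v)) ->
  (forall i j v, pr i (pr j v) = if i == j then pr j v else 0) ->
  (forall v, U v -> v = \sum_(i in P) pr i v) ->
  (forall i, i \in P -> has_dim (fun v => U v /\ pr i v = v) n) ->
  has_dim U (#|P| * n).
Proof.
move=> sU lpr Upr pr_pr prE prdim.
have /choice[F FE'] i : exists F : {linear V -> V}, pr i = F.
  exact: linear_fun.
have FE i v : pr i v = F i v by rewrite FE'.
have /choice[b bP] (i : 'I_#|P|) : exists b : 'I_n -> V,
    basis (fun v => U v /\ pr (enum_val i) v = v) b.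
  exact: prdim (enum_valP i).
have Ub i j : U (b i j) by case: (bP i) => h _ _; case: (h j).
have prb i j k : pr (enum_val i) (b k j) = if i == k then b k j else 0.
  have [h _ _] := bP k; rewrite -(h j).2 pr_pr (inj_eq enum_val_inj).
  by case: ifP => // _; rewrite (h j).2.
have -> : (#|P| * n)%N = #|{: 'I_#|P| * 'I_n}| by rewrite card_prod !card_ord.
apply: (@basis_has_dim _ _ _ (fun ij => b ij.1 ij.2)).
split=> [[i j]|c c0 [i j]|v Uv].
- exact: Ub.
- have [_ bf _] := bP i; apply: (bf (fun j => c (i, j))).
  have /esym := congr1 (pr (enum_val i)) c0; rewrite !FE linear0 => F0.
  apply: (etrans _ (esym F0)).
  transitivity (\sum_i' \sum_j F (enum_val i) (c (i', j) *: b i' j)); last first.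
    by rewrite linear_sum pair_bigA; apply: eq_bigr => -[].
  rewrite [RHS](bigD1 i) //= [X in _ + X]big1 ?addr0 => [|i' /negPf ni].
    by apply: eq_bigr => j' _; rewrite linearZ /= -FE prb eqxx.
  by rewrite big1 // => j' _; rewrite linearZ /= -FE prb eq_sym ni scaler0.
- have /choice[c cE] (i : 'I_#|P|) : exists c : 'I_n -> K,
      pr (enum_val i) v = \sum_j c j *: b i j.
    by have [_ _ bs] := bP i; apply: bs; split; [exact: Upr|rewrite pr_pr eqxx].
  exists (fun ij => c ij.1 ij.2); rewrite [LHS]prE // big_enum_val.
  rewrite -(pair_bigA _ (fun i j => c i j *: b i j)).
  by apply: eq_bigr => i _; exact: cE.
Qed.

(** Finitely many functionals on U induce on the quotient of U by their common
    kernel a full set of functionals, so some combinations of them are dual to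
    a family in U. *)
Lemma biorthogonal_system V (U : V -> Prop) (J : finType) (phi : J -> V -> K) :
  subspace U -> (forall x, scalar (phi x)) ->
  exists r (b : 'I_r -> V) (a : 'I_r -> J -> K),
    [/\ forall i, U (b i),
        forall i j, \sum_x a i x * phi x (b j) = (i == j)%:R
      & forall v, U v -> (forall i, \sum_x a i x * phi x v = 0) ->
          forall x, phi x v = 0].
Proof.
move=> sU lphi.
have dK : has_dim (fun _ : K^o => True) 1.
  exists (fun=> 1); split=> // [c|v _].
    rewrite big_ord1 => c0 i; rewrite ord1; move: c0.
    by rewrite /GRing.scale /= mulr1.
  by exists (fun=> v); rewrite big_ord1 /GRing.scale /= mulr1.
have sK : subspace (fun _ : K^o => True) by [].
have dW := has_dim_ffun J sK dK.
pose Phi v : {ffun J -> K^o} := [ffun x => phi x v].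
have lPhi : linear Phi by move=> a u v; apply/ffunP => x; rewrite !ffunE lphi.
have [F PhiF] := linear_fun lPhi.
have [||r [e [Ue ef es]]] :=
    has_dim_sub (U' := fun w => exists2 v, U v & Phi v = w) dW.
- split; first by exists 0; [case: sU|rewrite PhiF linear0].
  move=> a _ _ [u Uu <-] [v Uv <-]; exists (a *: u + v); last exact: lPhi.
  exact: sU.2.
- by [].
have /choice[b bP] i : exists v, U v /\ Phi v = e i.
  by have [v] := Ue i; exists v.
pose E : 'M[K]_(r, #|J|) := \matrix_(i, x) e i (enum_val x).
have /row_freeP[A EA] : row_free E.
  rewrite -kermx_eq0; apply/eqP/row_matrixP => k; rewrite row0; apply/rowP => i.
  rewrite [RHS]mxE; apply: (ef (row k (kermx E) 0)); apply/ffunP => x.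
  rewrite sum_ffunE ffunE.
  have := congr1 (fun M : 'M_(r, #|J|) => M k (enum_rank x)) (mulmx_ker E).
  rewrite !mxE => h; rewrite -[RHS]h; apply: eq_bigr => j _.
  by rewrite !mxE enum_rankK ffunE.
exists r, b, (fun i x => A (enum_rank x) i).
have sumE v i : \sum_x A (enum_rank x) i * phi x v =
    \sum_(x < #|J|) Phi v (enum_val x) * A x i.
  rewrite (reindex (@enum_val J J)) /=; last exact/onW_bij/enum_val_bij.
  by apply: eq_bigr => x _; rewrite enum_valK ffunE mulrC.
split=> [i|i j|v Uv v0 x]; first exact: (bP i).1.
- rewrite sumE (bP j).2 eq_sym; have := congr1 (fun M : 'M_r => M j i) EA.
  by rewrite !mxE => <-; apply: eq_bigr => x _; rewrite !mxE.
- have [|c cE] := es (Phi v); first by exists v.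
  suff Phi0 : Phi v = 0.
    by have := congr1 (fun f : {ffun J -> K^o} => f x) Phi0; rewrite !ffunE.
  rewrite cE big1 // => i _.
  suff -> : c i = 0 by rewrite scale0r.
  have := v0 i; rewrite sumE => <-.
  pose C : 'rV[K]_r := \row_i c i.
  have -> : c i = (C *m E *m A) 0 i by rewrite -mulmxA EA mulmx1 mxE.
  rewrite mxE; apply: eq_bigr => y _; congr (_ * _).
  by rewrite cE sum_ffunE mxE; apply: eq_bigr => k _; rewrite ffunE !mxE.
Qed.

End Dimension.

Section QWeyl.
Variables (K : fieldType) (q : K) (m : nat).
Hypotheses (qm : m.-primitive_root q) (m_gt1 : (1 < m)%N).

(** The q-number 1 + q + ... + q^(j-1). *)
Definition qnat j : K := \sum_(i < j) q ^+ i.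

Lemma qnatS j : qnat j.+1 = 1 + q * qnat j.
Proof.
rewrite /qnat big_ord_recl expr0 mulr_sumr; congr (_ + _).
by apply: eq_bigr => i _; rewrite -exprS.
Qed.

Lemma q_neq1 : q - 1 != 0.
Proof.
rewrite subr_eq0; apply: contraTneq m_gt1 => q1.
have : (m %| 1)%N by rewrite (prim_order_dvd qm) expr1 q1.
by rewrite dvdn1 => /eqP ->.
Qed.

Lemma qnat_prim : qnat m = 0.
Proof.
apply: (mulfI q_neq1); rewrite mulr0 -subrX1 (prim_expr_order qm).
by rewrite subrr.
Qed.

Lemma qnat_neq0 j : (0 < j < m)%N -> qnat j != 0.
Proof.
move=> /andP[j0 jm]; apply: contraTneq jm => nj0; rewrite -leqNgt.
apply: dvdn_leq => //; rewrite (prim_order_dvd qm) -subr_eq0 subrX1 -/(qnat j).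
by rewrite nj0 mulr0.
Qed.

Lemma prod_qnat_neq0 j : (j < m)%N -> \prod_(i < j) qnat i.+1 != 0.
Proof.
move=> jm; apply/prodf_neq0 => i _; apply: qnat_neq0.
exact: leq_ltn_trans (ltn_ord i) jm.
Qed.

(** By d x = 1 + q x d and d^m = 0 each vector is a unique sum of x^i v_i with
    i < m and d v_i = 0, as the q-numbers of 1, ..., m - 1 are invertible.
    Hence the dimension of U g is the sum over i < m of the dimensions of the
    kernels of d in U (g p^-i), and this sum does not change when g is
    multiplied by p, as p^m = 1. *)
Lemma qweyl_has_dim (V : lmodType K) (gT : finGroupType) (U : gT -> V -> Prop)
    (p : gT) (x d : V -> V) (N : nat) :
  has_dim (fun _ : V => True) N -> linear x -> linear d ->
  (forall g, subspace (U g)) ->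
  (forall g v, U g v -> U (g * p)%g (x v)) ->
  (forall g v, U (g * p)%g v -> U g (d v)) ->
  (forall g v, U g v -> d (x v) = v + q *: x (d v)) ->
  (forall g v, U g v -> iter m d v = 0) ->
  (p ^+ m)%g = 1%g ->
  forall g k l, has_dim (U g) k -> has_dim (U (g * p)%g) l -> k = l.
Proof.
move=> dV lx ld sU Ux Ud dx dm pm.
have [dL dE'] := linear_fun ld; have dE v : d v = dL v by rewrite dE'.
have [xL xE'] := linear_fun lx; have xE v : x v = xL v by rewrite xE'.
have sker g j : subspace (fun v => U g v /\ iter j d v = 0).
  have li := linear_iter j ld.
  split; first split; first by case: (sU g).
    by elim: (j) => //= i ->; rewrite dE linear0.
  move=> a u v [Uu u0] [Uv v0]; split; first exact: (sU g).2.
  by rewrite li u0 v0 scaler0 addr0.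
have /choice[k kP] g : exists k, has_dim (fun v => U g v /\ d v = 0) k.
  exact: has_dim_sub dV (sker g 1%N) _.
have Udj g j v : U g v -> U (g * p ^- j)%g (iter j d v).
  elim: j => [|j IHj] Uv; first by rewrite expg0 invg1 mulg1.
  by apply: Ud; rewrite expgS invMg -!mulgA mulVg mulg1; exact: IHj.
have Uxj g j v : U (g * p ^- j)%g v -> U g (iter j x v).
  elim: j v => [|j IHj] v; first by rewrite expg0 invg1 mulg1.
  rewrite iterSr expgS => Uv; apply: IHj.
  by have := Ux _ _ Uv; rewrite invMg -!mulgA mulVg mulg1.
have dxj g j v : U g v -> d v = 0 ->
    d (iter j.+1 x v) = qnat j.+1 *: iter j x v.
  move=> Uv v0; elim: j => [|j IHj].
    by rewrite /= (dx _ _ Uv) v0 xE linear0 scaler0 addr0 /qnat big_ord1 scale1r.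
  rewrite [iter j.+2 _ _]/= (dx (g * p ^+ j.+1)%g); last first.
    by apply: (Uxj _ j.+1); rewrite mulgK.
  rewrite IHj (xE (_ *: _)) linearZ /= -xE scalerA -[X in X + _]scale1r -scalerDl.
  by rewrite -qnatS.
have djxj g j v : U g v -> d v = 0 ->
    iter j d (iter j x v) = (\prod_(i < j) qnat i.+1) *: v.
  move=> Uv v0; elim: j => [|j IHj]; first by rewrite big_ord0 scale1r.
  have [G GE] := linear_fun (linear_iter j ld).
  rewrite iterSr (dxj g) // GE linearZ /= -GE IHj scalerA big_ord_recr /=.
  by rewrite mulrC.
have dimj g j : (j <= m)%N ->
    has_dim (fun v => U g v /\ iter j d v = 0) (\sum_(i < j) k (g * p ^- i)%g).
  elim: j => [|j IHj] jm.
    rewrite big_ord0; apply: has_dim_ext (@has_dim0 K V) => v; split=> [->|[]//].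
    by split=> //; case: (sU g).
  have li := linear_iter j ld.
  rewrite big_ord_recr; apply: (has_dim_rank (f := iter j d)) => //.
    apply: has_dim_ext (IHj (ltnW jm)) => v; split=> [[Uv v0]|[[Uv _] v0]//].
    by split=> //; split=> //=; rewrite v0 dE linear0.
  apply: has_dim_ext (kP _) => w; split=> [[Uw w0]|[v [Uv v0] <-]]; last first.
    by split; [exact: Udj|].
  pose c := \prod_(i < j) qnat i.+1; have c0 : c != 0 by exact: prod_qnat_neq0.
  exists (c^-1 *: iter j x w); last first.
    have := li c^-1 (iter j x w) 0.
    have -> : iter j d 0 = 0 by elim: (j) => //= i ->; rewrite dE linear0.
    by rewrite !addr0 => ->; rewrite (djxj _ _ _ Uw w0) scalerA mulVf ?scale1r.
  split; first by apply: subspaceZ => //; exact: Uxj.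
  have := (sker g j.+1).2 c^-1 (iter j x w) 0.
  move=> h; have [||_] := h _ _; last by rewrite addr0.
    split; first exact: Uxj.
    by rewrite iterS (djxj _ _ _ Uw w0) dE linearZ /= -dE w0 scaler0.
  by case: (sker g j.+1).
have dimU g : has_dim (U g) (\sum_(i < m) k (g * p ^- i)%g).
  apply: has_dim_ext (dimj g m (leqnn m)) => v.
  by split=> [[]//|Uv]; split=> //; exact: dm Uv.
move=> g a b /(has_dim_uniq (dimU g)) <- /(has_dim_uniq (dimU (g * p)%g)) <-.
have m_gt0 : (0 < m)%N by exact: ltnW.
case: (m) m_gt0 pm => // n _ pn.
rewrite big_ord_recr [RHS]big_ord_recl /= addnC; congr (_ + _)%N.
  rewrite expg0 invg1 mulg1; congr k; congr (_ * _)%g.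
  by apply/eqP; rewrite eq_invg_mul -expgSr pn.
by apply: eq_bigr => i _; rewrite /bump /= add1n expgSr invMg mulgA mulgK.
Qed.

End QWeyl.

(** * Algebras with skew derivations *)

(** Both the tensor algebra and the Nichols algebra are spanned by words and
    carry the same operators, determined by their values on words: the action
    of the g_t (twist), the derivations on the right and on the left (der and
    lder), the constant term (eps) and the projections on the components of
    degree g (homog).  The rules below compute them letter by letter from the
    left, so that identities between them are proved once for both algebras.
    The rule for lder removes the letter s |> t, as a letter t that moves to
    the left past s becomes s |> t. *)
Record deriv_alg (K : fieldType) (X : finRackType) (chi : X -> X -> K)
    (A : lalgType K) := DerivAlg {
  vgen : X -> A;
  word_ind : forall P : A -> Prop, subspace P -> P 1 ->
    (forall s x, P x -> P (vgen s * x)) -> forall x, P x;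
  mulZr : forall a (x y : A), a *: (x * y) = x * (a *: y);
  twist : X -> A -> A;
  twist_lin : forall t, linear (twist t);
  twist_one : forall t, twist t 1 = 1;
  twist_mul : forall t x y, twist t (x * y) = twist t x * twist t y;
  twist_vgen : forall t s, twist t (vgen s) = chi t s *: vgen (t |> s);
  der : X -> A -> A;
  der_lin : forall t, linear (der t);
  der_one : forall t, der t 1 = 0;
  der_vgenM : forall t s x,
    der t (vgen s * x) = vgen s * der t x + (if s == t then twist t x else 0);
  lder : X -> A -> A;
  lder_lin : forall t, linear (lder t);
  lder_one : forall t, lder t 1 = 0;
  lder_vgenM : forall t s x, lder (s |> t) (vgen s * x) =
    (if s == s |> t then x else 0) + chi s t *: (vgen s * lder t x);
  eps : A -> K;
  eps_lin : forall a x y, eps (a *: x + y) = a * eps x + eps y;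
  eps_one : eps 1 = 1;
  eps_vgenM : forall s x, eps (vgen s * x) = 0;
  homog : {perm X} -> A -> A;
  homog_lin : forall g, linear (homog g);
  homog_one : forall g, homog g 1 = if g == 1%g then 1 else 0;
  homog_vgenM : forall g s x,
    homog (g * lperm s)%g (vgen s * x) = vgen s * homog g x
}.

Section DerivAlg.
Variables (K : fieldType) (X : finRackType) (chi : X -> X -> K).
Hypothesis chi2 : cocycle2 chi.
Variables (A : lalgType K) (D : deriv_alg chi A).
Local Notation e := (vgen D).
Local Notation twist := (twist D).
Local Notation der := (der D).
Local Notation lder := (lder D).
Local Notation eps := (eps D).
Local Notation homog := (homog D).

Let wind := @word_ind _ _ _ _ D.

Lemma word_eq (W : lmodType K) (f g : A -> W) : linear f -> linear g ->
  f 1 = g 1 -> (forall s x, f x = g x -> f (e s * x) = g (e s * x)) -> f =1 g.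
Proof.
move=> lf lg fg1 fgS; refine (wind (P := fun x => f x = g x) _ _ _) => //.
split=> [|a x y fx fy].
  by rewrite (lin0 lf) (lin0 lg).
by rewrite lf lg fx fy.
Qed.

Lemma vgen_linr s : linear ( *%R (e s)).
Proof. by move=> a x y; rewrite mulrDr (mulZr D). Qed.

Lemma mulr_linl x : linear (fun y : A => y * x).
Proof. by move=> a y z; rewrite mulrDl scalerAl. Qed.

Lemma mulr_linr x : linear (fun y : A => x * y).
Proof. by move=> a y z; rewrite mulrDr (mulZr D). Qed.

Lemma rop_inj (t : X) : injective (rop t).
Proof. exact: bij_inj (rop_bij t). Qed.

Lemma ropP s (t : X) : exists t', s |> t' = t.
Proof. by have [f _ fK] := rop_bij s; exists (f t). Qed.

Lemma twist_rop t s x : twist t (twist s x) = twist (t |> s) (twist t x).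
Proof.
move: x; apply: word_eq => [a u v|a u v||r x IHx].
- by rewrite !twist_lin.
- by rewrite !twist_lin.
- by rewrite !twist_one.
rewrite !(twist_mul, twist_vgen, linZ (twist_lin D _)) IHx ropD -!scalerAl !scalerA.
by have [_ cc] := chi2; rewrite [in LHS]mulrC cc mulrC.
Qed.

Let epsL : linear (eps : A -> K^o). Proof. exact: eps_lin. Qed.

Lemma eps0 : eps 0 = 0. Proof. exact: lin0 epsL. Qed.

Lemma epsD x y : eps (x + y) = eps x + eps y. Proof. exact: linD epsL x y. Qed.

Lemma epsZ a x : eps (a *: x) = a * eps x. Proof. exact: linZ epsL a x. Qed.

Lemma eps_sum (I : finType) (F : I -> A) :
  eps (\sum_i F i) = \sum_i eps (F i).
Proof. exact: (lin_sum epsL). Qed.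

Lemma epsM x y : eps (x * y) = eps x * eps y.
Proof.
move: x; apply: (@word_eq K^o) => [a u v|a u v||s x _].
- by rewrite mulr_linl eps_lin.
- by rewrite eps_lin mulrDl -mulrA.
- by rewrite mul1r eps_one mul1r.
- by rewrite -mulrA !eps_vgenM mul0r.
Qed.

Lemma eps_twist t x : eps (twist t x) = eps x.
Proof.
move: x; apply: (@word_eq K^o) => [a u v|a u v||s x _].
- by rewrite twist_lin eps_lin.
- by rewrite eps_lin.
- by rewrite twist_one.
by rewrite twist_mul twist_vgen -scalerAl epsZ !eps_vgenM mulr0.
Qed.

(** The twisted Leibniz rule: a letter removed from x moves past y to the
    right end, where its action on y remains. *)
Lemma derM t x y : der t (x * y) = x * der t y + der t x * twist t y.
Proof.
move: x; apply: word_eq => [a u v|a u v||s x IHx].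
- by rewrite mulr_linl der_lin.
- by rewrite mulr_linl der_lin mulr_linl scalerDr addrACA.
- by rewrite !mul1r der_one mul0r addr0.
rewrite -mulrA !der_vgenM IHx mulrDr mulrDl !mulrA -!addrA; congr (_ + (_ + _)).
by case: ifP => _; rewrite ?mul0r // twist_mul.
Qed.

Lemma der_vgen t s : der t (e s) = (s == t)%:R.
Proof.
by rewrite -[e s]mulr1 der_vgenM der_one mulr0 add0r twist_one; case: ifP.
Qed.

Lemma der_twist t s x : der (t |> s) (twist t x) = chi t s *: twist t (der s x).
Proof.
move: x; apply: word_eq => [a u v|a u v||r x IHx].
- by rewrite twist_lin der_lin.
- by rewrite der_lin twist_lin scalerDr !scalerA mulrC.
- by rewrite twist_one !der_one (lin0 (twist_lin D t)) scaler0.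
rewrite twist_mul twist_vgen -scalerAl (linZ (der_lin D _)) !der_vgenM IHx.
rewrite (linD (twist_lin D t)) twist_mul twist_vgen -(mulZr D) -scalerAl.
rewrite (inj_eq (@rop_inj t)) !scalerDr !scalerA mulrC; congr (_ + _).
case: eqP => [->|_]; first by rewrite (twist_rop t s).
by rewrite (lin0 (twist_lin D t)) !scaler0.
Qed.

Lemma lder_twist t s x : lder (t |> s) (twist t x) = chi t s *: twist t (lder s x).
Proof.
elim/wind: x s => [|s|r x IHx s].
- split=> [s|a x y IHx IHy s].
    rewrite (lin0 (twist_lin D t)) !(lin0 (lder_lin D _)).
    by rewrite (lin0 (twist_lin D t)) scaler0.
  by rewrite twist_lin !lder_lin twist_lin IHx IHy scalerDr !scalerA mulrC.
- by rewrite twist_one !lder_one (lin0 (twist_lin D t)) scaler0.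
have [s' <-] := ropP r s.
rewrite twist_mul twist_vgen -scalerAl (linZ (lder_lin D _)) ropD !lder_vgenM -ropD.
rewrite IHx (linD (twist_lin D t)) (linZ (twist_lin D t)) twist_mul twist_vgen.
rewrite (inj_eq (@rop_inj t)) -(mulZr D) -scalerAl !scalerDr !scalerA.
have -> : (if r == r |> s' then twist t x else 0) =
    twist t (if r == r |> s' then x else 0).
  by case: ifP => // _; rewrite (lin0 (twist_lin D t)).
have [_ cc] := chi2; congr (_ + _).
  by case: eqP => [<-//|_]; rewrite (lin0 (twist_lin D t)) !scaler0.
by rewrite cc -mulrA [chi t r * _]mulrC.
Qed.

(** The two kinds of derivations remove letters through opposite ends of a
    word. *)
Lemma der_lder u t x : der u (lder t x) = lder t (der u x).
Proof.
elim/wind: x t => [|t|s x IHx t].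
- split=> [t|a x y IHx IHy t].
    by rewrite !(lin0 (lder_lin D _), lin0 (der_lin D _)).
  by rewrite !(lder_lin, der_lin) IHx IHy.
- by rewrite der_one lder_one (lin0 (lder_lin D _)) (lin0 (der_lin D _)).
have [t' <-] := ropP s t.
rewrite lder_vgenM (linD (der_lin D u)) (linZ (der_lin D u)) !der_vgenM.
rewrite (linD (lder_lin D _)) lder_vgenM IHx scalerDr -!addrA.
rewrite [X in _ = X + _](_ : _ = der u (if s == s |> t' then x else 0)); last first.
  by case: ifP => // _; rewrite (lin0 (der_lin D u)).
congr (_ + (_ + _)); case: eqP => [<-|_]; last first.
  by rewrite scaler0 (lin0 (lder_lin D _)).
by rewrite lder_twist.
Qed.

Lemma eps_lder t x : eps (lder t x) = eps (der t x).
Proof.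
elim/wind: x t => [|t|s x IHx t].
- split=> [t|a x y IHx IHy t].
    by rewrite (lin0 (lder_lin D _)) (lin0 (der_lin D _)).
  by rewrite lder_lin der_lin !eps_lin IHx IHy.
- by rewrite lder_one der_one.
have [t' <-] := ropP s t.
rewrite lder_vgenM der_vgenM !epsD epsZ !eps_vgenM mulr0 addr0 add0r.
by case: ifP => // _; rewrite eps_twist.
Qed.

Definition ders (u : seq X) (x : A) : A := foldr der x u.

Lemma ders_lin u : linear (ders u).
Proof.
by elim: u => //= t u IHu a x y; have /= -> := IHu a x y; rewrite der_lin.
Qed.

Lemma ders_rcons u t x : ders (rcons u t) x = ders u (der t x).
Proof. exact: foldr_rcons. Qed.

Lemma ders_cat u v x : ders (u ++ v) x = ders u (ders v x).
Proof. exact: foldr_cat. Qed.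

Lemma ders_lder u t x : ders u (lder t x) = lder t (ders u x).
Proof. by elim: u => //= s u ->; rewrite der_lder. Qed.

Lemma ders_one t u : ders (t :: u) 1 = 0.
Proof.
elim/last_ind: u => [|u s _]; first exact: der_one.
by rewrite -rcons_cons ders_rcons der_one (lin0 (ders_lin _)).
Qed.

Lemma ropVK (t s : X) : t |> (lperm t)^-1%g s = s.
Proof. by have := permKV (lperm t) s; rewrite [lperm t _]permE. Qed.

Lemma ders_twist t u x : exists c,
  ders u (twist t x) = c *: twist t (ders [seq (lperm t)^-1%g s | s <- u] x).
Proof.
elim: u => [|s u [c IHu]]; first by exists 1; rewrite scale1r.
exists (c * chi t ((lperm t)^-1%g s)).
by rewrite /= IHu (linZ (der_lin D _)) -{1}(ropVK t s) der_twist scalerA.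
Qed.

(** A derivation q-commutes with the action of its generator, so that the
    correction term of its n-th power carries a q-number, which vanishes when
    n > 1 is the order of q. *)
Lemma der_pow t n s x (q := chi t t) : t |> t = t ->
  iter n (der t) (e s * x) = e s * iter n (der t) x +
    (if s == t then qnat q n *: twist t (iter n.-1 (der t) x) else 0).
Proof.
move=> tt; have da y : der t (twist t y) = q *: twist t (der t y).
  by rewrite -{1}tt der_twist.
elim: n => [|n IHn]; first by rewrite /qnat big_ord0 scale0r if_same addr0.
rewrite iterS IHn (linD (der_lin D t)) der_vgenM -addrA; congr (_ + _).
case: eqP => _; last by rewrite (lin0 (der_lin D t)) addr0.
rewrite (linZ (der_lin D t)) da scalerA /=.
case: n {IHn} => [|n].
  by rewrite /qnat big_ord0 mul0r scale0r addr0 big_ord1 scale1r.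
by rewrite -[X in X + _]scale1r -scalerDl [in RHS]qnatS [q * _]mulrC.
Qed.

Lemma der_pow0 t m x : t |> t = t -> (1 < m)%N ->
  m.-primitive_root (chi t t) -> iter m (der t) x = 0.
Proof.
move=> tt m1 qm; have lm := linear_iter m (der_lin D t).
move: x; apply: (@word_eq _ _ (fun=> 0)) => //= [a u v||s x IHx].
- by rewrite scaler0 addr0.
- case: m {qm lm} m1 => // m _; rewrite iterSr der_one.
  exact: lin0 (linear_iter m (der_lin D t)).
by rewrite der_pow // IHx mulr0 (qnat_prim qm) // scale0r if_same addr0.
Qed.

Lemma homog_homog g h x : homog g (homog h x) = if g == h then homog h x else 0.
Proof.
elim/wind: x g h => [|g h|s x IHx g h].
- split=> [g h|a x y IHx IHy g h].
    by rewrite !(lin0 (homog_lin D _)) if_same.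
  by rewrite !homog_lin IHx IHy; case: eqP; rewrite ?scaler0 ?addr0.
- rewrite !homog_one; case: (h =P 1%g) => [->|_]; first by rewrite homog_one.
  by rewrite (lin0 (homog_lin D g)) if_same.
rewrite -[g](mulgKV (lperm s)) -[h](mulgKV (lperm s)) !homog_vgenM IHx.
rewrite !(inj_eq (mulIg _)).
by case: ifP; rewrite ?mulr0.
Qed.

Lemma homog_out g x : g \notin Inn X -> homog g x = 0.
Proof.
elim/wind: x g => [|g gX|s x IHx g gX].
- split=> [g _|a x y IHx IHy g gX]; first exact: lin0 (homog_lin D g).
  by rewrite homog_lin IHx // IHy // scaler0 addr0.
- by rewrite homog_one; case: eqP gX => // ->; rewrite group1.
have sX : lperm s \in Inn X by apply/mem_gen/imset_f.
rewrite -[g](mulgKV (lperm s)) homog_vgenM IHx ?mulr0 //.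
by rewrite groupMr ?groupV.
Qed.

Lemma homog_sum x : x = \sum_(g in Inn X) homog g x.
Proof.
have -> : \sum_(g in Inn X) homog g x = \sum_g homog g x.
  rewrite [RHS](bigID (mem (Inn X))) /= [X in _ + X]big1 ?addr0 // => g.
  exact: homog_out.
move: x; apply: word_eq => [//|a u v||s x IHx].
- rewrite scaler_sumr -big_split; apply: eq_bigr => g _.
  exact: homog_lin.
- rewrite (bigD1 1%g) //= homog_one eqxx big1 ?addr0 // => g /negPf g1.
  by rewrite homog_one g1.
rewrite (reindex_inj (mulIg (lperm s))) /= {1}IHx mulr_sumr.
by apply: eq_bigr => g _; rewrite homog_vgenM.
Qed.

Lemma eps_homog g x : eps (homog g x) = if g == 1%g then eps x else 0.
Proof.
elim/wind: x g => [|g|s x IHx g].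
- split=> [g|a x y IHx IHy g].
    by rewrite (lin0 (homog_lin D g)) eps0 if_same.
  by rewrite homog_lin !eps_lin IHx IHy; case: ifP; rewrite ?mulr0 ?addr0.
- by rewrite homog_one; case: ifP; rewrite ?eps0.
by rewrite -[g](mulgKV (lperm s)) homog_vgenM !eps_vgenM if_same.
Qed.

Lemma lpermJ t s : (lperm s ^ lperm t)%g = lperm (t |> s) :> {perm X}.
Proof.
by apply/permP=> x; rewrite -(permKV (lperm t) x) permJ !permE ropD.
Qed.

Lemma homog_twist g t x : homog (g ^ lperm t)%g (twist t x) = twist t (homog g x).
Proof.
have a0 := lin0 (twist_lin D t).
elim/wind: x g => [|g|s x IHx g].
- split=> [g|a x y IHx IHy g].
    by rewrite a0 !(lin0 (homog_lin D _)) a0.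
  by rewrite !(twist_lin, homog_lin) IHx IHy.
- rewrite twist_one !homog_one conjg_eq1; case: ifP => _ //.
    exact/esym/twist_one.
rewrite -[g](mulgKV (lperm s)) homog_vgenM !twist_mul !twist_vgen -!scalerAl.
by rewrite (linZ (homog_lin D _)) conjMg lpermJ homog_vgenM IHx.
Qed.

Lemma homog_der g t x : der t (homog (lperm t * g)%g x) = homog g (der t x).
Proof.
have d0 := lin0 (der_lin D t).
elim/wind: x g => [|g|s x IHx g].
- split=> [g|a x y IHx IHy g].
    by rewrite d0 !(lin0 (homog_lin D _)) d0.
  by rewrite !(der_lin, homog_lin) IHx IHy.
- rewrite homog_one der_one (lin0 (homog_lin D g)).
  by case: ifP => _; rewrite ?der_one.
rewrite -{1}[g](mulgKV (lperm s)) mulgA homog_vgenM !der_vgenM IHx.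
rewrite (linD (homog_lin D g)).
rewrite -[in homog g (e s * _)](mulgKV (lperm s) g) homog_vgenM.
congr (_ + _); case: eqP => [->|_]; last by rewrite (lin0 (homog_lin D g)).
by rewrite -homog_twist conjgE !mulgA mulVg mul1g mulgKV.
Qed.

Lemma homog_lder g t x : lder t (homog (g * lperm t)%g x) = homog g (lder t x).
Proof.
have l0 t' := lin0 (lder_lin D t').
elim/wind: x g t => [|g t|s x IHx g t].
- split=> [g t|a x y IHx IHy g t].
    by rewrite l0 !(lin0 (homog_lin D _)) l0.
  by rewrite !(lder_lin, homog_lin) IHx IHy.
- rewrite homog_one lder_one (lin0 (homog_lin D g)).
  by case: ifP => _; rewrite ?lder_one.
have [t' <-] := ropP s t.
rewrite lder_vgenM (linD (homog_lin D g)) (linZ (homog_lin D g)).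
rewrite (_ : g * lperm (s |> t') =
             g * (lperm s)^-1 * lperm t' * lperm s)%g; last first.
  by rewrite -lpermJ conjgE !mulgA.
rewrite homog_vgenM lder_vgenM IHx.
rewrite -[in homog g (e s * _)](mulgKV (lperm s) g) homog_vgenM.
congr (_ + _); case: eqP => [st|_]; last by rewrite (lin0 (homog_lin D g)).
suff -> : lperm t' = lperm s by rewrite mulgKV.
by apply: (conjg_inj (lperm s)); rewrite lpermJ -st conjgE mulKg.
Qed.

(** By nichols_idealP this is the defining ideal of the Nichols algebra when A
    is the tensor algebra. *)
Definition null x := forall u, eps (ders u x) = 0.

Lemma null_subspace : subspace null.
Proof.
split=> [u|a x y nx ny u]; first by rewrite (lin0 (ders_lin u)) eps0.
by rewrite ders_lin eps_lin nx ny mulr0 addr0.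
Qed.

Lemma null_der t x : null x -> null (der t x).
Proof. by move=> nx u; rewrite -ders_rcons. Qed.

Lemma nullP x : eps x = 0 -> (forall t, null (der t x)) -> null x.
Proof. by move=> x0 nx; elim/last_ind => [//|u t _]; rewrite ders_rcons nx. Qed.

Lemma null_twist t x : null x -> null (twist t x).
Proof.
by move=> nx u; have [c ->] := ders_twist t u x; rewrite epsZ eps_twist nx mulr0.
Qed.

(** Both Leibniz terms of a derivative of a product have a factor that is null
    again, which reduces the number of derivations. *)
Lemma null_mul a x : null x -> null (a * x) /\ null (x * a).
Proof.
have eD u v y z : eps (ders u y) = 0 -> eps (ders v z) = 0 -> u = v ->
    eps (ders u (y + z)) = 0.
  by move=> y0 z0 uv; rewrite (linD (ders_lin u)) epsD y0 uv z0 addr0.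
move=> nx; split=> u; elim/last_ind: u a x nx => [|u t IHu] a x nx.
- by rewrite epsM (nx [::]) mulr0.
- rewrite ders_rcons derM; apply: eD (erefl u).
    exact: IHu (null_der t nx).
  exact: IHu (null_twist t nx).
- by rewrite epsM (nx [::]) mul0r.
- rewrite ders_rcons derM addrC; apply: eD (erefl u).
    exact: IHu (null_der t nx).
  exact: IHu nx.
Qed.

Lemma null_lder t x : null x -> null (lder t x).
Proof. by move=> nx u; rewrite ders_lder eps_lder; exact: (nx (t :: u)). Qed.

Lemma null_homog g x : null x -> null (homog g x).
Proof.
move=> nx u; elim/last_ind: u x g nx => [|u t IHu] x g nx.
  by rewrite eps_homog (nx [::]) if_same.
by rewrite ders_rcons -[g](mulKVg (lperm t)) homog_der IHu //; exact: null_der.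
Qed.

End DerivAlg.

(** * The coproduct and the derivations *)

(** The tensor square enters only through its generation by pure tensors and
    a few maps given on them: prim s is the multiplication by the coproduct of
    the letter s, and ctr applies the constant term to the second factor. *)
Section BraidedCoproduct.
Variables (K : fieldType) (X : finRackType) (chi : X -> X -> K).
Hypothesis chi2 : cocycle2 chi.
Variables (A : lalgType K) (D : deriv_alg chi A).
Local Notation e := (vgen D).
Local Notation twist := (twist D).
Local Notation der := (der D).
Local Notation eps := (eps D).
Variables (T : lmodType K) (tens : A -> A -> T).
Variables (prim : X -> T -> T) (Delta : A -> T).
Variables (tmap : (A -> A) -> (A -> A) -> T -> T) (ctr : T -> A).

Hypothesis T_eq : forall (W : lmodType K) (f g : T -> W), linear f -> linear g ->
  (forall x y, f (tens x y) = g (tens x y)) -> f =1 g.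
Hypothesis tens_linl : forall y a x z,
  tens (a *: x + z) y = a *: tens x y + tens z y.
Hypothesis tens_linr : forall x a y z,
  tens x (a *: y + z) = a *: tens x y + tens x z.
Hypothesis prim_lin : forall s, linear (prim s).
Hypothesis primE : forall s x y,
  prim s (tens x y) = tens (e s * x) y + tens (twist s x) (e s * y).
Hypothesis Delta_lin : linear Delta.
Hypothesis Delta1 : Delta 1 = tens 1 1.
Hypothesis Delta_e : forall s x, Delta (e s * x) = prim s (Delta x).
Hypothesis tmap_lin : forall f g, linear (tmap f g).
Hypothesis tmapE : forall f g x y, linear f -> linear g ->
  tmap f g (tens x y) = tens (f x) (g y).
Hypothesis ctr_lin : linear ctr.
Hypothesis ctrE : forall x y, ctr (tens x y) = eps y *: x.

Let twistL t : linear (twist t). Proof. exact: twist_lin. Qed.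
Let derL t : linear (der t). Proof. exact: der_lin. Qed.
Let dersL u : linear (ders D u). Proof. exact: ders_lin. Qed.

Let tensZl a x y : tens (a *: x) y = a *: tens x y.
Proof. exact: (linZ (fun a x z => tens_linl y a x z)). Qed.

Let tensZr a x y : tens x (a *: y) = a *: tens x y.
Proof. exact: (linZ (tens_linr x)). Qed.

Let tens0 x : tens x 0 = 0.
Proof. exact: (lin0 (tens_linr x)). Qed.

Let tensDr x y z : tens x (y + z) = tens x y + tens x z.
Proof. exact: (linD (tens_linr x)). Qed.

Lemma coprod_twist t x : Delta (twist t x) = tmap (twist t) (twist t) (Delta x).
Proof.
move: x; apply: (word_eq (D := D)) => [a u v|a u v||s x IHx].
- by rewrite (twist_lin D) Delta_lin.
- by rewrite Delta_lin tmap_lin.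
- by rewrite twist_one Delta1 tmapE // !twist_one.
rewrite twist_mul twist_vgen -scalerAl (linZ Delta_lin) !Delta_e IHx.
move: (Delta x); apply: T_eq => [a u v|a u v|u v].
- by rewrite tmap_lin prim_lin scalerDr !scalerA mulrC.
- by rewrite prim_lin tmap_lin.
rewrite primE (linD (@tmap_lin _ _)) !tmapE // primE !twist_mul twist_vgen.
by rewrite -!scalerAl tensZl tensZr scalerDr (twist_rop chi2 D t s).
Qed.

(** Half of coassociativity: the last tensor factor of the coproduct is
    differentiated like the argument. *)
Lemma coprod_der t x : Delta (der t x) = tmap id (der t) (Delta x).
Proof.
have lid : linear (@id A) by [].
move: x; apply: (word_eq (D := D)) => [a u v|a u v||s x IHx].
- by rewrite (der_lin D) Delta_lin.
- by rewrite Delta_lin tmap_lin.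
- by rewrite Delta1 tmapE // der_one tens0 (lin0 Delta_lin).
rewrite der_vgenM (linD Delta_lin) !Delta_e IHx.
have -> : Delta (if s == t then twist t x else 0) =
    (s == t)%:R *: tmap (twist t) (twist t) (Delta x).
  rewrite -coprod_twist; case: eqP => _; first by rewrite scale1r.
  by rewrite scale0r (lin0 Delta_lin).
move: (Delta x); apply: T_eq => [a u v|a u v|u v].
- by rewrite !tmap_lin prim_lin !scalerDr addrACA !scalerA mulrC.
- by rewrite prim_lin tmap_lin.
rewrite primE (linD (@tmap_lin _ _)) !tmapE // primE -addrA; congr (_ + _).
rewrite der_vgenM tensDr; congr (_ + _).
by case: eqP => [->|_]; rewrite ?scale1r // scale0r tens0.
Qed.

Lemma coprod_counit x : ctr (Delta x) = x.
Proof.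
move: x; apply: (word_eq (D := D)) => [a u v|//||s x IHx].
- by rewrite Delta_lin ctr_lin.
- by rewrite Delta1 ctrE eps_one scale1r.
rewrite Delta_e -[in RHS]IHx; move: (Delta x); apply: T_eq => [a u v|a u v|u v].
- by rewrite prim_lin ctr_lin.
- by rewrite ctr_lin mulrDr (mulZr D).
by rewrite primE (linD ctr_lin) !ctrE eps_vgenM scale0r addr0 (mulZr D).
Qed.

(** Pairing the last tensor factor with a word amounts to differentiating by
    this word. *)
Lemma coprod_ders (W : lmodType K) (f : A -> W) (F : T -> W) (v : seq X) x :
  linear f -> linear F ->
  (forall y z, F (tens y z) = eps (ders D v z) *: f y) ->
  F (Delta x) = f (ders D v x).
Proof.
move=> lf lF FE.
have lid : linear (@id A) by [].
have DE u : Delta (ders D u x) = tmap id (ders D u) (Delta x).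
  elim: u => [|t u IHu].
    by move: (Delta x); apply: T_eq => // y z; rewrite tmapE.
  rewrite coprod_der IHu; move: (Delta x); apply: T_eq => [a y z|//|y z].
    by rewrite !tmap_lin.
  by rewrite !tmapE //; exact: (ders_lin D (t :: u)).
rewrite -[ders D v x]coprod_counit DE; move: (Delta x).
apply: T_eq => [//|a y z|y z]; first by rewrite tmap_lin ctr_lin lf.
by rewrite FE tmapE // ctrE (linZ lf).
Qed.

End BraidedCoproduct.

(** * The tensor algebra *)

Lemma linear_add (K : fieldType) (V W : lmodType K) (f g : V -> W) :
  linear f -> linear g -> linear (fun x => f x + g x).
Proof.
move=> lf lg a x y; have /= -> := lf a x y; have /= -> := lg a x y.
by rewrite scalerDr addrACA.
Qed.

Section FreeLinear.
Variables (K : fieldType) (I : choiceType).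
Implicit Types (W : lmodType K) (x : {malg K[I]}).

Lemma lin_extU W (F : I -> W) i : lin_ext F (<< i >> : {malg K[I]}) = F i.
Proof.
by rewrite /lin_ext msuppU oner_eq0 big_seq_fset1 mcoeffUU scale1r.
Qed.

Lemma malg_sumE x : x = \sum_(i <- msupp x) x@_i *: << i >>.
Proof.
rewrite [LHS]monalgE; apply: eq_bigr => i _; apply/malgP => j.
by rewrite mcoeffZ !mcoeffU mulr_natr.
Qed.

Lemma malg_linear_eq W (f g : {malg K[I]} -> W) :
  linear f -> linear g -> (forall i, f << i >> = g << i >>) -> f =1 g.
Proof.
move=> /linear_fun[F ->] /linear_fun[G ->] FG x; rewrite [x]malg_sumE.
by rewrite !linear_sum; apply: eq_bigr => i _; rewrite !linearZ /= FG.
Qed.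

Lemma lin_ext_fun W (F F1 F2 : I -> W) (a : K) x :
  (forall i, F i = a *: F1 i + F2 i) ->
  lin_ext F x = a *: lin_ext F1 x + lin_ext F2 x.
Proof.
move=> FE; rewrite /lin_ext scaler_sumr -big_split /=; apply: eq_bigr => i _.
by rewrite FE scalerDr !scalerA mulrC.
Qed.

End FreeLinear.

Section Derivations.
Variables (K : fieldType) (X : finRackType) (chi : X -> X -> K).

Local Notation TV := {malg K[word X]}.
Local Notation TVTV := {malg K[(word X * word X)%type]}.
Local Notation wm := (@wmon K X).
Local Notation act := (Defs.gact chi).

Lemma wmonM (u v : word X) : wm u * wm v = wm (u ++ v).
Proof. by rewrite /wmon malgM_def fgmulUU mulr1. Qed.

Lemma wmon_nil : wm [::] = 1. Proof. by []. Qed.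

Lemma wmon_cons s (w : word X) : wm (s :: w) = tgen K s * wm w.
Proof. by rewrite /tgen wmonM. Qed.

Lemma TV_linear_eq (W : lmodType K) (f g : TV -> W) :
  linear f -> linear g -> (forall w, f (wm w) = g (wm w)) -> f =1 g.
Proof. exact: malg_linear_eq. Qed.

Lemma gact_lin t : linear (act t). Proof. exact: lin_ext_linear. Qed.

Lemma mul_linl z (a : K) (u v : TV) : (a *: u + v) * z = a *: (u * z) + v * z.
Proof. by rewrite mulrDl -scalerAl. Qed.

Lemma mul_linr z (a : K) (u v : TV) : z * (a *: u + v) = a *: (z * u) + z * v.
Proof. by rewrite mulrDr malg_scalerAr. Qed.

Lemma gact_wmon t w :
  act t (wm w) = (\prod_(s <- w) chi t s) *: wm [seq t |> s | s <- w].
Proof. exact: lin_extU. Qed.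

Lemma gact_one t : act t 1 = 1.
Proof. by rewrite -wmon_nil gact_wmon big_nil scale1r. Qed.

Lemma gact_gen t s : act t (tgen K s) = chi t s *: tgen K (t |> s).
Proof. by rewrite gact_wmon big_seq1. Qed.

Lemma gact_mul t x y : act t (x * y) = act t x * act t y.
Proof.
move: x; apply: TV_linear_eq => [a u v|a u v|u].
- by rewrite mul_linl gact_lin.
- by rewrite gact_lin mul_linl.
move: y; apply: TV_linear_eq => [a x y|a x y|v].
- by rewrite mul_linr gact_lin.
- by rewrite gact_lin mul_linr.
rewrite wmonM !gact_wmon big_cat map_cat -wmonM.
by rewrite -scalerAl -malg_scalerAr scalerA.
Qed.

Fixpoint rder_word (t : X) (w : word X) : TV :=
  if w is s :: w' then
    tgen K s * rder_word t w' + (if s == t then act t (wm w') else 0)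
  else 0.
Definition rder t : TV -> TV := lin_ext (rder_word t).

Lemma rder_lin t : linear (rder t). Proof. exact: lin_ext_linear. Qed.

Lemma rder_wmon t w : rder t (wm w) = rder_word t w.
Proof. exact: lin_extU. Qed.

Lemma rder1 t : rder t 1 = 0.
Proof. by rewrite -wmon_nil rder_wmon. Qed.

Lemma rder_genM t s z : rder t (tgen K s * z) =
  tgen K s * rder t z + (if s == t then act t z else 0).
Proof.
move: z; apply: TV_linear_eq => [a u v|a u v|w].
- by rewrite mul_linr rder_lin.
- rewrite rder_lin gact_lin mul_linr scalerDr addrACA.
  by case: ifP; rewrite ?scaler0 ?addr0.
- by rewrite -wmon_cons !rder_wmon.
Qed.

Definition counit (x : TV) : K := x@_[::].

Lemma counit_lin a x y : counit (a *: x + y) = a * counit x + counit y.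
Proof. by rewrite /counit mcoeffD mcoeffZ. Qed.

Lemma counit_wmon w : counit (wm w) = (w == [::])%:R.
Proof. by rewrite /counit /wmon mcoeffU. Qed.

Lemma counit_genM s x : counit (tgen K s * x) = 0.
Proof.
move: x; apply: (@TV_linear_eq K^o) => [a u v|a u v|w].
- by rewrite mul_linr counit_lin.
- by rewrite scaler0 addr0.
- by rewrite -wmon_cons counit_wmon.
Qed.

Fixpoint lder_word (w : word X) (t : X) : TV :=
  if w is s :: w' then
    (if s == t then wm w' else 0) +
    chi s ((lperm s)^-1%g t) *: (tgen K s * lder_word w' ((lperm s)^-1%g t))
  else 0.
Definition free_lder t : TV -> TV := lin_ext (lder_word^~ t).

Lemma free_lder_lin t : linear (free_lder t). Proof. exact: lin_ext_linear. Qed.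

Lemma free_lder_wmon t w : free_lder t (wm w) = lder_word w t.
Proof. exact: lin_extU. Qed.

Lemma free_lder_genM s t x : free_lder (s |> t) (tgen K s * x) =
  (if s == s |> t then x else 0) + chi s t *: (tgen K s * free_lder t x).
Proof.
have st : (lperm s)^-1%g (s |> t) = t.
  by have := permK (lperm s) t; rewrite [lperm s t]permE.
move: x; apply: TV_linear_eq => [a u v|a u v|w].
- by rewrite mul_linr free_lder_lin.
- rewrite free_lder_lin mul_linr !scalerDr !scalerA (mulrC (chi s t)) addrACA.
  by case: ifP => _; rewrite ?scaler0 ?addr0.
- by rewrite -wmon_cons !free_lder_wmon /= st.
Qed.

Definition free_homog (g : {perm X}) : TV -> TV :=
  lin_ext (fun w : word X => if word_deg w == g then wm w else 0).

Lemma free_homog_lin g : linear (free_homog g). Proof. exact: lin_ext_linear. Qed.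

Lemma free_homog_wmon g w :
  free_homog g (wm w) = if word_deg w == g then wm w else 0.
Proof. exact: lin_extU. Qed.

Lemma free_homog_genM g s x :
  free_homog (g * lperm s)%g (tgen K s * x) = tgen K s * free_homog g x.
Proof.
move: x; apply: TV_linear_eq => [a u v|a u v|w].
- by rewrite mul_linr free_homog_lin.
- by rewrite free_homog_lin mul_linr.
rewrite -wmon_cons !free_homog_wmon /= (inj_eq (mulIg _)).
by case: ifP => _; rewrite ?mulr0 // wmon_cons.
Qed.

Lemma free_word_ind (P : TV -> Prop) : subspace P -> P 1 ->
  (forall s x, P x -> P (tgen K s * x)) -> forall x, P x.
Proof.
move=> sP P1 PS x; rewrite [x]malg_sumE; apply: subspace_sum => // w _.
apply: subspaceZ => //; rewrite -/(wm w).
by elim: w => [|s w IHw]; [rewrite wmon_nil|rewrite wmon_cons; exact: PS].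
Qed.

Definition free_deriv : deriv_alg chi {malg K[word X]}.
Proof.
pose L := {malg K[word X]} : lalgType K.
refine (@DerivAlg K X chi L (@tgen K X) _ _ (Defs.gact chi) _ _ _ _ rder _ _ _
  free_lder _ _ _ counit _ _ _ free_homog _ _ _).
- exact: free_word_ind.
- exact: malg_scalerAr.
- exact: gact_lin.
- exact: gact_one.
- exact: gact_mul.
- exact: gact_gen.
- exact: rder_lin.
- exact: rder1.
- exact: rder_genM.
- exact: free_lder_lin.
- by move=> t; rewrite -wmon_nil free_lder_wmon.
- by move=> t s x; exact: free_lder_genM.
- exact: counit_lin.
- by rewrite -wmon_nil counit_wmon.
- exact: counit_genM.
- exact: free_homog_lin.
- by move=> g; rewrite -wmon_nil free_homog_wmon /= eq_sym.
- exact: free_homog_genM.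
Defined.

Local Notation tens := (@tens K X).

Lemma tens_wmon u v : tens (wm u) (wm v) = << (u, v) >>.
Proof. by rewrite /tens !lin_extU. Qed.

Lemma tens_linl y a x z : tens (a *: x + z) y = a *: tens x y + tens z y.
Proof. exact: lin_ext_linear. Qed.

Lemma tens_linr x a y z : tens x (a *: y + z) = a *: tens x y + tens x z.
Proof.
rewrite /Defs.tens /=.
by apply: lin_ext_fun => u; exact: lin_ext_linear.
Qed.

Lemma lin_ext_tens (W : lmodType K) (F : (word X * word X)%type -> W) u v :
  lin_ext F (tens (wm u) (wm v)) = F (u, v).
Proof. by rewrite tens_wmon lin_extU. Qed.

Lemma tensZl a x y : tens (a *: x) y = a *: tens x y.
Proof. exact: (linZ (fun a x z => tens_linl y a x z)). Qed.

Lemma tensZr a x y : tens x (a *: y) = a *: tens x y.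
Proof. exact: (linZ (tens_linr x)). Qed.

Lemma TVTV_linear_eq (W : lmodType K) (f g : TVTV -> W) :
  linear f -> linear g ->
  (forall u v, f (tens (wm u) (wm v)) = g (tens (wm u) (wm v))) -> f =1 g.
Proof.
by move=> lf lg fg; apply: malg_linear_eq => // -[u v]; rewrite -tens_wmon.
Qed.

(** The linear map sending x (x) y to F x y, for a bilinear F. *)
Definition tens_rec (W : lmodType K) (F : TV -> TV -> W) : TVTV -> W :=
  lin_ext (fun p => F (wm p.1) (wm p.2)).

Lemma tens_rec_lin (W : lmodType K) (F : TV -> TV -> W) : linear (tens_rec F).
Proof. exact: lin_ext_linear. Qed.

Lemma tens_recE (W : lmodType K) (F : TV -> TV -> W) x y :
  (forall y, linear (F^~ y)) -> (forall x, linear (F x)) ->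
  tens_rec F (tens x y) = F x y.
Proof.
move=> Fl Fr; move: x; apply: TV_linear_eq => [a u v|a u v|u].
- by rewrite tens_linl tens_rec_lin.
- exact: Fl.
move: y; apply: TV_linear_eq => [a x y|a x y|v].
- by rewrite tens_linr tens_rec_lin.
- exact: Fr.
by rewrite tens_wmon /tens_rec lin_extU.
Qed.

Definition tmap (f g : TV -> TV) : TVTV -> TVTV :=
  tens_rec (fun x y => tens (f x) (g y)).

Lemma tmap_lin f g : linear (tmap f g).
Proof. exact: lin_ext_linear. Qed.

Lemma tmapE f g x y : linear f -> linear g ->
  tmap f g (tens x y) = tens (f x) (g y).
Proof.
move=> lf lg; apply: tens_recE => [z a u v|z a u v].
  by rewrite lf tens_linl.
by rewrite lg tens_linr.
Qed.

(** Multiplication on the left by the coproduct of tgen s. *)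
Definition prim_mul s : TVTV -> TVTV :=
  tens_rec (fun x y => tens (tgen K s * x) y + tens (act s x) (tgen K s * y)).

Lemma prim_mul_lin s : linear (prim_mul s).
Proof. exact: lin_ext_linear. Qed.

Lemma prim_mulE s x y : prim_mul s (tens x y) =
  tens (tgen K s * x) y + tens (act s x) (tgen K s * y).
Proof.
rewrite /prim_mul tens_recE // => z a u v.
  by rewrite mul_linr gact_lin !tens_linl scalerDr addrACA.
by rewrite mul_linr !tens_linr scalerDr addrACA.
Qed.

Lemma coprod_lin : linear (coprod chi).
Proof. exact: lin_ext_linear. Qed.

Lemma coprod_cons s w :
  coprod chi (wm (s :: w)) = prim_mul s (coprod chi (wm w)).
Proof.
rewrite /coprod !lin_extU /=; set Q := coprod_word _ _; move: Q.
rewrite -wmon_nil !tens_wmon.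
set P := << _ >> + << _ >>.
have bE Q : braided_mul chi P Q = lin_ext (fun q =>
    tens (wm [:: s] * word_act chi [::] (wm q.1)) (wm [::] * wm q.2)) Q
  + lin_ext (fun q =>
    tens (wm [::] * word_act chi [:: s] (wm q.1)) (wm [:: s] * wm q.2)) Q.
  by rewrite /braided_mul /P (linD (@lin_ext_linear _ _ _ _)) !lin_extU.
move=> Q; rewrite bE; move: Q; apply: TVTV_linear_eq => [|a u v|u v].
- exact: linear_add (lin_ext_linear _) (lin_ext_linear _).
- by rewrite prim_mul_lin.
rewrite [RHS]prim_mulE; congr (_ + _); rewrite lin_ext_tens /=.
  by rewrite [wm [::] * _]mul1r.
by congr (tens _ _); exact: mul1r.
Qed.

Lemma coprod1 : coprod chi (wm [::]) = tens 1 1.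
Proof. by rewrite /coprod lin_extU. Qed.

Hypothesis chi2 : cocycle2 chi.

Lemma coprod_genM s x : coprod chi (tgen K s * x) = prim_mul s (coprod chi x).
Proof.
move: x; apply: TV_linear_eq => [a u v|a u v|w].
- by rewrite mul_linr coprod_lin.
- by rewrite coprod_lin prim_mul_lin.
by rewrite -wmon_cons coprod_cons.
Qed.

Lemma coprod_pair (W : lmodType K) (f : TV -> W) (F : TVTV -> W) v x :
  linear f -> linear F ->
  (forall y z, F (tens y z) = counit (ders free_deriv v z) *: f y) ->
  F (coprod chi x) = f (ders free_deriv v x).
Proof.
pose ctr := tens_rec (fun x y => counit y *: x).
have ctrE y z : ctr (tens y z) = counit z *: y.
  rewrite /ctr tens_recE // => [u a y1 y2|u a y1 y2].
    by rewrite scalerDr !scalerA (mulrC a).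
  by rewrite counit_lin scalerDl scalerA.
apply: (@coprod_ders K X chi chi2 _ free_deriv TVTV tens prim_mul (coprod chi)
  tmap ctr).
- by move=> W' g h lg lh gh; apply: TVTV_linear_eq => // u w; exact: gh.
- exact: tens_linl.
- exact: tens_linr.
- exact: prim_mul_lin.
- exact: prim_mulE.
- exact: coprod_lin.
- exact: coprod1.
- exact: coprod_genM.
- exact: tmap_lin.
- exact: tmapE.
- exact: tens_rec_lin.
- exact: ctrE.
Qed.

End Derivations.

(** * The defining ideal of the Nichols algebra *)

Section TensorKernel.
Variables (K : fieldType) (A T : lmodType K) (tens : A -> A -> T).
Variables (I : Type) (f : I -> A -> K).
Hypothesis tens_linl : forall y, linear (tens^~ y).
Hypothesis tens_linr : forall x, linear (tens x).
Hypothesis f_lin : forall i, scalar (f i).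

(** A tensor killed by all f i (x) f j lies in N (x) A + A (x) N, where N is
    the common kernel of the f i: either the left factors are independent
    modulo N, and then the right factors are in N, or the tensor can be
    written with fewer terms. *)
Lemma tens_kernel n (a b : 'I_n -> A) :
  (forall i j, \sum_k f i (a k) * f j (b k) = 0) ->
  exists2 s : seq (A * A), \sum_k tens (a k) (b k) = \sum_(p <- s) tens p.1 p.2
    & forall p, p \in s -> (forall i, f i p.1 = 0) \/ (forall i, f i p.2 = 0).
Proof.
pose fL i : linear (f i : A -> K^o) := f_lin i.
have f_sum i m (c : 'I_m -> K) (x : 'I_m -> A) :
    f i (\sum_k c k *: x k) = \sum_k c k * f i (x k).
  rewrite (lin_sum (fL i)); apply: eq_bigr => k _; exact: (linZ (fL i)).
elim: n a b => [|n IHn] a b ab0; first by exists [::]; rewrite ?big_ord0 ?big_nil.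
have [[c [k0 ck0] ca0]|indep] := pselect (exists2 c : 'I_n.+1 -> K,
    exists k, c k != 0 & forall i, f i (\sum_k c k *: a k) = 0); last first.
  exists [seq (a k, b k) | k : 'I_n.+1].
    by rewrite big_image.
  move=> _ /imageP[k _ ->] /=; right=> j; apply: contrapT => /eqP fb.
  apply: indep; exists (fun k => f j (b k)); first by exists k.
  by move=> i; rewrite f_sum -[RHS](ab0 i j); apply: eq_bigr => l _; rewrite mulrC.
pose d k := - ((c k0)^-1 * c (lift k0 k)).
pose z := a k0 - \sum_k d k *: a (lift k0 k).
have split_k0 (V : nmodType) (F : 'I_n.+1 -> V) :
    \sum_k F k = F k0 + \sum_k F (lift k0 k).
  by rewrite (bigD1_ord k0).
have zE : z = (c k0)^-1 *: \sum_k c k *: a k.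
  rewrite /z split_k0 scalerDr scalerA mulVf // scale1r scaler_sumr -sumrN.
  by congr (_ + _); apply: eq_bigr => k _; rewrite -scaleNr opprK scalerA.
have z0 i : f i z = 0 by rewrite zE (linZ (fL i)) ca0 scaler0.
pose b' k := d k *: b k0 + b (lift k0 k).
have [|s sE sP] := IHn (fun k => a (lift k0 k)) b'.
- move=> i j; rewrite -[RHS](ab0 i j) split_k0.
  have -> : a k0 = z + \sum_k d k *: a (lift k0 k) by rewrite subrK.
  rewrite (linD (fL i)) z0 add0r f_sum mulr_suml -big_split; apply: eq_bigr => k _.
  by rewrite f_lin mulrDr mulrCA mulrA.
exists ((z, b k0) :: s).
  rewrite big_cons -sE split_k0 /=.
  rewrite (linB (@tens_linl (b k0))) (lin_sum (@tens_linl (b k0))).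
  rewrite -addrA; congr (_ + _).
  rewrite -sumrN -big_split; apply: eq_bigr => k _ /=.
  rewrite tens_linr (linZ (@tens_linl (b k0))).
  by rewrite addKr.
by move=> p; rewrite inE => /orP[/eqP->|/sP//]; left.
Qed.

End TensorKernel.

Section Ideal.
Variables (K : fieldType) (X : finRackType) (chi : X -> X -> K).
Hypothesis chi2 : cocycle2 chi.

Local Notation TV := {malg K[word X]}.
Local Notation TVTV := {malg K[(word X * word X)%type]}.
Local Notation wm := (@wmon K X).
Local Notation tens := (@tens K X).
Local Notation D := (free_deriv chi).
Local Notation hc := (@hcomp K X).

Lemma hcomp_lin n : linear (hc n). Proof. exact: lin_ext_linear. Qed.

Lemma hcomp_wmon n w : hc n (wm w) = if size w == n then wm w else 0.
Proof. exact: lin_extU. Qed.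

Lemma hcomp_genS n s x : hc n.+1 (tgen K s * x) = tgen K s * hc n x.
Proof.
move: x; apply: TV_linear_eq => [a u v|a u v|w].
- by rewrite mul_linr hcomp_lin.
- by rewrite hcomp_lin mul_linr.
rewrite -wmon_cons !hcomp_wmon eqSS.
by case: ifP => _; rewrite ?mulr0 // wmon_cons.
Qed.

Lemma hcomp_gen0 s x : hc 0 (tgen K s * x) = 0.
Proof.
move: x; apply: TV_linear_eq => [a u v|a u v|w].
- by rewrite mul_linr hcomp_lin.
- by rewrite scaler0 addr0.
- by rewrite -wmon_cons hcomp_wmon.
Qed.

Lemma mcoeff_hcomp n x w : (hc n x)@_w = if size w == n then x@_w else 0.
Proof.
move: x; apply: (@TV_linear_eq K X K^o) => [a u v|a u v|v].
- by rewrite hcomp_lin mcoeffD mcoeffZ.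
- by rewrite mcoeffD mcoeffZ; case: ifP; rewrite ?scaler0 ?addr0.
rewrite hcomp_wmon /wmon; case: (eqVneq v w) => [->|vw].
  by case: ifP => _; rewrite ?mcoeff0.
by case: ifP; rewrite ?mcoeff0 !mcoeffU (negPf vw) if_same.
Qed.

Lemma hcomp_gact n t x : hc n (Defs.gact chi t x) = Defs.gact chi t (hc n x).
Proof.
move: x; apply: TV_linear_eq => [a u v|a u v|w].
- by rewrite gact_lin hcomp_lin.
- by rewrite hcomp_lin gact_lin.
rewrite gact_wmon (linZ (hcomp_lin n)) !hcomp_wmon size_map.
by case: ifP => _; rewrite ?gact_wmon // (lin0 (gact_lin chi t)) scaler0.
Qed.

Lemma rder_hcomp n t x : rder chi t (hc n.+1 x) = hc n (rder chi t x).
Proof.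
elim/(@free_word_ind K X): x n => [|n|s x IHx n].
- split=> [n|a x y IHx IHy n].
    by rewrite (lin0 (hcomp_lin _)) (lin0 (rder_lin _ _)) (lin0 (hcomp_lin _)).
  by rewrite hcomp_lin !rder_lin hcomp_lin IHx IHy.
- by rewrite -wmon_nil hcomp_wmon rder1 (lin0 (rder_lin _ _)) (lin0 (hcomp_lin _)).
rewrite hcomp_genS !rder_genM (linD (hcomp_lin n)).
have -> : hc n (if s == t then Defs.gact chi t x else 0) =
    if s == t then Defs.gact chi t (hc n x) else 0.
  by case: ifP => _; rewrite ?hcomp_gact // (lin0 (hcomp_lin n)).
case: n => [|n]; last by rewrite IHx hcomp_genS.
rewrite hcomp_gen0 -[X in _ * X](_ : 0 = _) ?mulr0 //.
elim/(@free_word_ind K X): x {IHx} => [||r x _].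
- split=> [|a x y IHx IHy].
    by rewrite (lin0 (hcomp_lin _)) (lin0 (rder_lin _ _)).
  by rewrite hcomp_lin rder_lin -IHx -IHy scaler0 addr0.
- by rewrite -wmon_nil hcomp_wmon rder1.
- by rewrite hcomp_gen0 (lin0 (rder_lin _ _)).
Qed.

Lemma counit_rder t x : counit (rder chi t x) = x@_[:: t].
Proof.
move: x; apply: (@TV_linear_eq K X K^o) => [a u v|a u v|w].
- by rewrite rder_lin counit_lin.
- by rewrite mcoeffD mcoeffZ.
case: w => [|s w]; first by rewrite wmon_nil rder1 /counit mcoeff0 /wmon mcoeffU.
rewrite wmon_cons rder_genM /counit mcoeffD -/(counit (tgen K s * _)) counit_genM.
rewrite add0r -wmon_cons /wmon mcoeffU eqseq_cons -/(counit _); case: eqP => _ /=.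
  by have /= -> := eps_twist D t (wm w); rewrite counit_wmon.
by rewrite /counit mcoeff0.
Qed.

(** A derivation is obtained from the coproduct by pairing the last factor
    with an element of degree 1.  As the ideal has no elements of degree less
    than 2, these pairings and the constant term vanish on it, so the coideal
    property makes the ideal stable under derivations. *)
Lemma ideal_null x : nichols_ideal chi x -> null D x.
Proof.
have [[I0 ID IM] Ih Ic Id] := nichols_ideal_admissible chi.
have hc0 n y : nichols_ideal chi y -> (n < 2)%N -> hc n y = 0.
  move=> Iy n2; apply/eqP; apply: contraTT n2 => ny; rewrite -leqNgt.
  apply: (Id (hc n y) n (Ih y n Iy)) => //; apply/malgP => w.
  by rewrite !mcoeff_hcomp; case: (size w == n).
have coef0 w y : nichols_ideal chi y -> (size w < 2)%N -> y@_w = 0.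
  move=> Iy w2; have := congr1 (mcoeff w) (hc0 _ _ Iy w2).
  by rewrite mcoeff_hcomp eqxx mcoeff0.
have Ider t y : nichols_ideal chi y -> nichols_ideal chi (rder chi t y).
  move=> Iy; have [s sE sI] := Ic y Iy.
  pose F := tens_rec (fun y z => counit (rder chi t z) *: y).
  have FE u v : F (tens u v) = counit (rder chi t v) *: u.
    rewrite /F tens_recE // => [z a y1 y2|z a y1 y2].
      by rewrite scalerDr !scalerA (mulrC a).
    by rewrite rder_lin counit_lin scalerDl scalerA.
  have FL : linear F := tens_rec_lin _.
  have lid : linear (@id TV) by [].
  have <- : F (coprod chi y) = rder chi t y.
    exact: (coprod_pair chi2 (v := [:: t]) (f := id) _ lid FL FE).
  rewrite sE (lin_sum FL) big_seq; elim/big_ind: _ => // p /sI sp; rewrite FE.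
  case: sp => Ip; first by rewrite -mul_malgC; exact: (IM _ _ Ip).1.
  by rewrite counit_rder coef0 ?scale0r.
move=> Ix u; elim/last_ind: u x Ix => [|u t IHu] x Ix; first exact: coef0.
by rewrite ders_rcons; apply: IHu; exact: Ider.
Qed.

Lemma ders_hcomp n u x :
  eps D (ders D u (hc n x)) = if size u == n then eps D (ders D u x) else 0.
Proof.
elim/last_ind: u n x => [|u t IHu] n x.
  by rewrite /= /counit mcoeff_hcomp.
rewrite size_rcons !ders_rcons.
case: n => [|n]; last by rewrite [der D t _]rder_hcomp IHu.
suff -> : der D t (hc 0 x) = 0 by rewrite (lin0 (ders_lin _ _)) eps0.
apply/malgP => w; move: w; apply/malgP; move: x.
elim/(@free_word_ind K X) => [||s x _].
- split=> [|a x y IHx IHy].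
    by rewrite (lin0 (hcomp_lin _)) (lin0 (der_lin D _)).
  by rewrite hcomp_lin der_lin IHx IHy scaler0 addr0.
- by rewrite -wmon_nil hcomp_wmon; exact: rder1.
- by rewrite hcomp_gen0 (lin0 (der_lin D _)).
Qed.

(** For the coideal property, pairing both factors of the coproduct of x with
    two words is pairing x with their concatenation, hence gives 0, and
    tens_kernel applies. *)
Lemma null_admissible : nichols_admissible chi (null D).
Proof.
have sN := null_subspace D; split.
- split=> [|x y nx ny|a x nx]; first by case: sN.
    exact: (subspaceD sN nx ny).
  exact: null_mul.
- by move=> x n nx u; rewrite ders_hcomp nx if_same.
- move=> x nx.
  have fL u : scalar (fun y => eps D (ders D u y)).
    by move=> a y z; rewrite ders_lin eps_lin.
  pose r : seq (word X * word X) := msupp (coprod chi x).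
  pose a (k : 'I_(size r)) : TV :=
    (coprod chi x)@_(tnth (in_tuple r) k) *: wm (tnth (in_tuple r) k).1.
  pose b (k : 'I_(size r)) : TV := wm (tnth (in_tuple r) k).2.
  have xE : coprod chi x = \sum_k tens (a k) (b k).
    rewrite [LHS]malg_sumE big_tnth; apply: eq_bigr => k _.
    by rewrite /a /b tensZl tens_wmon -surjective_pairing.
  have [||i j|s sE sP] := tens_kernel (tens := tens)
    (f := fun u y => eps D (ders D u y)) _ _ fL (a := a) (b := b).
  + by move=> y c u v; exact: tens_linl.
  + by move=> y c u v; exact: tens_linr.
  + pose F : TVTV -> K^o := tens_rec
      (fun y z : TV => (eps D (ders D i y) * eps D (ders D j z) : K^o)).
    have FE y z : F (tens y z) = eps D (ders D i y) * eps D (ders D j z).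
      rewrite /F tens_recE // => [w c y1 y2|w c y1 y2].
        by rewrite fL mulrDl -mulrA.
      by rewrite fL mulrDr mulrCA.
    have FL : linear F := tens_rec_lin _.
    have F0 : F (coprod chi x) = 0.
      rewrite (coprod_pair chi2 (v := j) (f := fun y => eps D (ders D i y) : K^o)
        x (fL i) FL) => [|y z]; first by rewrite -ders_cat; exact: nx.
      by rewrite FE; exact: mulrC.
    apply: etrans F0; rewrite xE (lin_sum FL); apply: eq_bigr => k _.
    by rewrite FE.
  by exists s; rewrite ?xE.
- move=> x n nx xn x0; case: n xn => [|[|n]] // xn; case/eqP: x0.
    rewrite -xn; apply/malgP => w; rewrite mcoeff_hcomp mcoeff0.
    by case: eqP => // /size0nil ->; exact: (nx [::]).
  rewrite -xn; apply/malgP => w; rewrite mcoeff_hcomp mcoeff0.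
  case: w => [|t [|s w]] //=; rewrite -counit_rder; exact: (nx [:: t]).
Qed.

Lemma nichols_idealP x : nichols_ideal chi x <-> null D x.
Proof.
split; first exact: ideal_null.
by move=> nx; exists (null D) => //; exact: null_admissible.
Qed.

End Ideal.

(** * The derivations of the Nichols algebra *)

Section NicholsDeriv.
Variables (K : fieldType) (X : finRackType) (chi : X -> X -> K).
Hypothesis chi2 : cocycle2 chi.

Local Notation TV := {malg K[word X]}.
Local Notation wm := (@wmon K X).
Local Notation D := (free_deriv chi).
Local Notation B := (nichols chi).
Local Notation proj := (@nproj K X chi).
Local Notation repr := generic_quotient.repr.

Lemma nproj_lin : linear (proj : TV -> B).
Proof. by move=> a x y; rewrite nprojD nprojZ. Qed.

Lemma nproj_mul x y : proj (x * y) = proj x * proj y :> B.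
Proof. exact: nprojM. Qed.

Lemma nproj1 : proj 1 = 1 :> B. Proof. by []. Qed.

Lemma nproj_ind (P : B -> Prop) : (forall x, P (proj x)) -> forall b, P b.
Proof. by move=> Px b; rewrite -[b]nreprK. Qed.

Lemma nproj_null x y : (proj x = proj y) <-> null D (x - y).
Proof.
rewrite -(nichols_idealP chi2); split=> [/nproj_eq/nichols_predP//|Ixy].
by apply/nproj_eq/nichols_predP.
Qed.

Lemma nproj_eq0 x : (proj x = 0 :> B) <-> null D x.
Proof. by rewrite -(lin0 nproj_lin) nproj_null subr0. Qed.

Section Lift.
Variable f : TV -> TV.
Hypotheses (f_lin : linear f) (f_null : forall x, null D x -> null D (f x)).

Definition nlift (b : B) : B := proj (f (repr b)).

Lemma nliftE x : nlift (proj x) = proj (f x).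
Proof.
by apply/nproj_null; rewrite -(linB f_lin); apply/f_null/nproj_null/nreprK.
Qed.

Lemma nlift_lin : linear nlift.
Proof.
move=> a; elim/nproj_ind => x; elim/nproj_ind => y.
by rewrite -nproj_lin !nliftE f_lin nproj_lin.
Qed.

End Lift.

Definition neps (b : B) : K := counit (repr b).

Lemma nepsE x : neps (proj x) = counit x.
Proof.
have := (proj1 (nproj_null _ _) (nreprK (proj x))) [::].
rewrite /neps /= /counit mcoeffB => /eqP; rewrite subr_eq0 => /eqP.
exact.
Qed.

Let tw t := nlift (twist D t).
Let nd t := nlift (der D t).
Let nl t := nlift (lder D t).
Let nh g := nlift (homog D g).

Let twE t x : tw t (proj x) = proj (twist D t x).
Proof. by apply: nliftE; [exact: twist_lin|exact: null_twist]. Qed.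
Let ndE t x : nd t (proj x) = proj (der D t x).
Proof. by apply: nliftE; [exact: der_lin|exact: null_der]. Qed.
Let nlE t x : nl t (proj x) = proj (lder D t x).
Proof. by apply: nliftE; [exact: lder_lin|exact: null_lder]. Qed.
Let nhE g x : nh g (proj x) = proj (homog D g x).
Proof. by apply: nliftE; [exact: homog_lin|exact: null_homog]. Qed.

Definition nichols_deriv : deriv_alg chi B.
Proof.
refine (@DerivAlg K X chi B (@ngen K X chi) _ _ tw _ _ _ _ nd _ _ _
  nl _ _ _ neps _ _ _ nh _ _ _).
- move=> P sP P1 PS b; elim/nproj_ind: b => x.
  elim/(@word_ind _ _ _ _ D): x => [||s x Px].
  + split=> [|a x y Px Py]; first by rewrite (lin0 nproj_lin); case: sP.
    by rewrite nproj_lin; exact: sP.2.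
  + exact: P1.
  + by rewrite nproj_mul; exact: PS.
- exact: nscaleAr.
- by move=> t; apply: nlift_lin; [exact: twist_lin|exact: null_twist].
- by move=> t; rewrite -nproj1 twE twist_one.
- move=> t; elim/nproj_ind => x; elim/nproj_ind => y.
  by rewrite -nproj_mul !twE twist_mul nproj_mul.
- by move=> t s; rewrite /ngen twE [twist _ _ _](twist_vgen D) (linZ nproj_lin).
- by move=> t; apply: nlift_lin; [exact: der_lin|exact: null_der].
- by move=> t; rewrite -nproj1 ndE der_one (lin0 nproj_lin).
- move=> t s; elim/nproj_ind => x.
  rewrite /ngen -nproj_mul ndE [der _ _ _](der_vgenM D) (linD nproj_lin) nproj_mul.
  by rewrite ndE twE; case: ifP => _ //; rewrite (lin0 nproj_lin).
- by move=> t; apply: nlift_lin; [exact: lder_lin|exact: null_lder].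
- by move=> t; rewrite -nproj1 nlE lder_one (lin0 nproj_lin).
- move=> t s; elim/nproj_ind => x.
  rewrite /ngen -nproj_mul !nlE [lder _ _ _](lder_vgenM D) (linD nproj_lin).
  rewrite (linZ nproj_lin) nproj_mul.
  by case: ifP => _ //; rewrite (lin0 nproj_lin).
- move=> a; elim/nproj_ind => x; elim/nproj_ind => y.
  by rewrite -nproj_lin !nepsE counit_lin.
- by rewrite -nproj1 nepsE; exact: (eps_one D).
- by move=> s; elim/nproj_ind => x; rewrite /ngen -nproj_mul nepsE counit_genM.
- by move=> g; apply: nlift_lin; [exact: homog_lin|exact: null_homog].
- move=> g; rewrite -nproj1 nhE homog_one; case: ifP => // _.
  exact: lin0 nproj_lin.
- move=> g s; elim/nproj_ind => x.
  by rewrite /ngen -nproj_mul !nhE [homog _ _ _](homog_vgenM D) nproj_mul.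
Defined.

Local Notation E := nichols_deriv.

Lemma nichols_ders u x : ders E u (proj x) = proj (ders D u x).
Proof. by elim: u => //= t u ->; exact: ndE. Qed.

Lemma nichols_eps x : eps E (proj x) = eps D x.
Proof. exact: nepsE. Qed.

Lemma nichols_homog g x : homog E g (proj x) = proj (homog D g x).
Proof. exact: nhE. Qed.

Lemma nichols_sep b : null E b -> b = 0.
Proof.
elim/nproj_ind: b => x nx; apply/nproj_eq0 => u.
by rewrite -nichols_eps -nichols_ders.
Qed.

Lemma ncompP g b : ncomp chi g b <-> homog E g b = b.
Proof.
split=> [[x xg ->]|].
  rewrite nichols_homog; congr proj.
  have hE : homog D g x =
    \sum_(w <- msupp x) x@_w *: (if word_deg w == g then wm w else 0) by [].
  rewrite hE [RHS]malg_sumE big_seq [RHS]big_seq; apply: eq_bigr => w /xg ->.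
  by rewrite eqxx.
elim/nproj_ind: b => x; rewrite nichols_homog => hx.
exists (homog D g x); last exact/esym.
move=> w; rewrite -mcoeff_neq0; apply: contraNeq => wg; apply/eqP.
move: {hx} x; apply: (@TV_linear_eq K X K^o _ (fun=> 0)) => [a u v|a u v|v] /=.
- by rewrite free_homog_lin mcoeffD mcoeffZ.
- by rewrite scaler0 addr0.
rewrite free_homog_wmon; case: (word_deg v =P g) => [vg|_]; last exact: mcoeff0.
rewrite /wmon mcoeffU; case: (v =P w) => // vw; case/eqP: wg.
by rewrite -vw.
Qed.

Lemma ncomp_subspace g : subspace (ncomp chi g).
Proof.
split=> [|a x y /ncompP hx /ncompP hy]; apply/ncompP.
  exact: lin0 (homog_lin E g).
by rewrite homog_lin hx hy.
Qed.

End NicholsDeriv.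

(** * Cofreeness over the subalgebra of a subrack *)

Section Factorization.
Variables (K : fieldType) (X : finRackType) (chi : X -> X -> K).
Hypothesis chi2 : cocycle2 chi.
Variables (A : lalgType K) (D : deriv_alg chi A).
Hypothesis sep : forall x, null D x -> x = 0.
Variable N : nat.
Hypothesis dimA : has_dim (fun _ : A => True) N.
Variable X' : {set X}.
Hypothesis subX' : subrack X'.

Local Notation e := (vgen D).
Local Notation twist := (twist D).
Local Notation der := (der D).
Local Notation lder := (lder D).
Local Notation eps := (eps D).
Local Notation homog := (homog D).
Local Notation ders := (ders D).

(** As long as the letter s stays in front the constant term is 0, so a
    contribution comes from a letter of u that removes s, while the other
    letters differentiate x up to a twist. *)
Lemma vanish_vgenM (Q : nat -> Prop) s x :
  (forall u, Q (size u) -> eps (ders u x) = 0) ->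
  forall u, (forall k, size u = k.+1 -> Q k) -> eps (ders u (e s * x)) = 0.
Proof.
move=> Qx u; elim/last_ind: u Q x Qx => [|u t IHu] Q x Qx Qu.
  exact: eps_vgenM.
have Qsu : Q (size u) by apply: Qu; rewrite size_rcons.
rewrite ders_rcons der_vgenM (linD (ders_lin D u)) epsD.
rewrite (IHu (fun k => Q k.+1)) ?add0r => [|v Qv|k uk].
- case: ifP => _; last by rewrite (lin0 (ders_lin D u)) eps0.
  have [c ->] := ders_twist chi2 D t u x.
  by rewrite epsZ eps_twist Qx ?mulr0 // size_map.
- by rewrite -ders_rcons Qx // size_rcons.
- by rewrite -uk.
Qed.

Lemma ders_nilp x : exists n, forall u, (n <= size u)%N -> ders u x = 0.
Proof.
suff [n xn] : exists n, forall u, (n <= size u)%N -> eps (ders u x) = 0.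
  exists n => u nu; apply: sep => v; rewrite -ders_cat xn // size_cat.
  exact: leq_trans nu (leq_addl _ _).
elim/(@word_ind _ _ _ _ D): x => [||s x [n xn]].
- split=> [|a x y [n xn] [k yk]].
    by exists 0%N => u _; rewrite (lin0 (ders_lin D u)) eps0.
  exists (maxn n k) => u; rewrite geq_max => /andP[nu ku].
  by rewrite ders_lin eps_lin xn // yk // mulr0 addr0.
- by exists 1%N => -[|t u] // _; rewrite ders_one eps0.
- exists n.+1 => u nu; apply: (vanish_vgenM (Q := fun k => n <= k)%N) => [v|k uk].
    exact: xn.
  by move: nu; rewrite uk.
Qed.

Lemma ders_nilp_unif : exists n, forall u x, (n <= size u)%N -> ders u x = 0.
Proof.
have [b [_ _ bs]] := dimA; have /choice[n nP] i := ders_nilp (b i).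
exists (\max_i n i) => u x nu; have [//|c ->] := bs x.
rewrite (lin_sum (ders_lin D u)) big1 // => i _.
by rewrite (linZ (ders_lin D u)) nP ?scaler0 // (leq_trans _ nu) // leq_bigmax.
Qed.

Lemma der_const y : (forall t, der t y = 0) -> y = eps y *: 1.
Proof.
move=> y0; apply/eqP; rewrite -subr_eq0; apply/eqP/sep/nullP => [|t].
  rewrite -scaleN1r epsD !epsZ eps_one.
  by rewrite mulr1 mulN1r subrr.
rewrite (linB (der_lin D t)) y0 (linZ (der_lin D t)) der_one scaler0 subrr.
by case: (null_subspace D).
Qed.

Definition mon (u : seq X) : A := foldr (fun s x => e s * x) 1 u.

Lemma mon_span (P : A -> Prop) : subspace P -> (forall u, P (mon u)) ->
  forall x, P x.
Proof.
move=> sP Pm x; elim/(@word_ind _ _ _ _ D): x P sP Pm => [|P _ Pm|s x IHx P sP Pm].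
- split=> [P sP _|a x y Px Py P sP Pm]; first by case: sP.
  by apply: sP.2; [exact: Px|exact: Py].
- exact: (Pm [::]).
- apply: (IHx (fun y => P (e s * y))) => [|u]; last exact: (Pm (s :: u)).
  split=> [|a y z Py Pz]; first by rewrite mulr0; case: sP.
  by rewrite mulrDr -(mulZr D); exact: sP.2.
Qed.

Lemma eps_ders_mon w u : size w != size u -> eps (ders w (mon u)) = 0.
Proof.
elim: u w => [|s u IHu] w wu; last first.
  by apply: (vanish_vgenM (Q := fun k => k != size u)) => [v|k wk];
    [exact: IHu|rewrite wk in wu].
by case: w wu => // t w _; rewrite ders_one eps0.
Qed.

Lemma ders_mon w u : (size u < size w)%N -> ders w (mon u) = 0.
Proof.
move=> uw; apply: sep => v; rewrite -ders_cat eps_ders_mon // size_cat.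
by rewrite neq_ltn orbC (leq_trans uw) ?leq_addl.
Qed.

Definition subalg (b : A) := forall S : {pred A}, GRing.subalg_closed S ->
  (forall t, t \in X' -> e t \in S) -> b \in S.

Lemma subalg_one : subalg 1.
Proof. by move=> S [S1 _ _] _. Qed.

Lemma subalg_vgen t : t \in X' -> subalg (e t).
Proof. by move=> tX S _; exact. Qed.

Lemma subalg_mul x y : subalg x -> subalg y -> subalg (x * y).
Proof.
by move=> Bx By S cS SX; have [_ _ SM] := cS; apply: SM; [exact: Bx|exact: By].
Qed.

Lemma subalg_subspace : subspace subalg.
Proof.
have Slin S : @GRing.subalg_closed K A S -> forall a x y,
    x \in S -> y \in S -> a *: x + y \in S.
  by case=> _ SL _; exact: SL.
split=> [S cS _|a x y Bx By S cS SX]; last first.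
  by apply: Slin => //; [exact: Bx|exact: By].
have [S1 _ _] := cS; rewrite -[0](addNr 1) -scaleN1r.
exact: Slin.
Qed.

Lemma subalg_ind (P : A -> Prop) : subspace P -> P 1 ->
  (forall x y, subalg x -> subalg y -> P x -> P y -> P (x * y)) ->
  (forall t, t \in X' -> P (e t)) -> forall b, subalg b -> P b.
Proof.
move=> sP P1 PM PX b Bb.
pose S : {pred A} := [pred x | `[< subalg x /\ P x >]].
have SP x : reflect (subalg x /\ P x) (x \in S) by exact: asboolP.
suff: b \in S by case/SP.
apply: Bb => [|t tX]; last by apply/SP; split; [exact: subalg_vgen|exact: PX].
split=> [|a x y /SP[Bx Px] /SP[By Py]|x y /SP[Bx Px] /SP[By Py]]; apply/SP.
- by split=> //; exact: subalg_one.
- by split; [exact: subalg_subspace.2|exact: sP.2].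
- by split; [exact: subalg_mul|exact: PM].
Qed.

Lemma der_subalg_out t b : t \notin X' -> subalg b -> der t b = 0.
Proof.
move=> tX; elim/subalg_ind => [||x y _ _ x0 y0|s sX].
- split=> [|a x y x0 y0]; first exact: lin0 (der_lin D t).
  by rewrite der_lin x0 y0 scaler0 addr0.
- exact: der_one.
- by rewrite derM x0 y0 mulr0 mul0r addr0.
- by rewrite der_vgen; case: eqP tX => // <-; rewrite sX.
Qed.

Lemma subalg_twist s b : s \in X' -> subalg b -> subalg (twist s b).
Proof.
move=> sX; elim/subalg_ind => [||x y _ _ Bx By|t tX].
- split=> [|a x y Bx By].
    by rewrite (lin0 (twist_lin D s)); case: subalg_subspace.
  by rewrite twist_lin; exact: subalg_subspace.2.
- by rewrite twist_one; exact: subalg_one.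
- by rewrite twist_mul; exact: subalg_mul.
rewrite twist_vgen; apply: (subspaceZ _ subalg_subspace).
by apply: subalg_vgen; rewrite -(subX' sX) imset_f.
Qed.

Lemma subalg_der s b : s \in X' -> subalg b -> subalg (der s b).
Proof.
have [B0 _] := subalg_subspace.
move=> sX; elim/subalg_ind => [||x y Bx By dx dy|t tX].
- split=> [|a x y Bx By]; first by rewrite (lin0 (der_lin D s)).
  by rewrite der_lin; exact: subalg_subspace.2.
- by rewrite der_one.
- rewrite derM; apply: (subspaceD subalg_subspace); apply: subalg_mul => //.
  exact: subalg_twist.
- by rewrite der_vgen; case: eqP => _ //; exact: subalg_one.
Qed.

Lemma subalg_ders u b : {subset u <= X'} -> subalg b -> subalg (ders u b).
Proof.
elim: u => //= s u IHu uX Bb; apply: subalg_der; first exact/uX/mem_head.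
by apply: IHu => // t tu; apply: uX; rewrite inE tu orbT.
Qed.

Lemma subalg_mon u : {subset u <= X'} -> subalg (mon u).
Proof.
elim: u => [_|s u IHu uX]; first exact: subalg_one.
apply: subalg_mul; first exact/subalg_vgen/uX/mem_head.
by apply: IHu => t tu; apply: uX; rewrite inE tu orbT.
Qed.

(** Letters outside a subrack are never removed by the derivations of the
    subrack, as its action moves them outside the subrack. *)
Lemma eps_ders_out w u :
  {subset w <= X'} -> ~~ all [in X'] u -> eps (ders w (mon u)) = 0.
Proof.
have rX s t : s \in X' -> (lperm s)^-1%g t \in X' = (t \in X').
  move=> sX; apply/idP/idP => tX.
    by rewrite -[t](ropVK s) -(subX' sX) imset_f.
  move: tX; rewrite -{1}(subX' sX) => /imsetP[r rX ->].
  by have := permK (lperm s) r; rewrite [lperm s r]permE => ->.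
have sub_rcons v t : {subset rcons v t <= X'} -> {subset v <= X'} /\ t \in X'.
  move=> vX; split=> [r rv|]; apply: vX; rewrite mem_rcons inE ?rv ?orbT //.
  by rewrite eqxx.
pose Z x := forall v, {subset v <= X'} -> eps (ders v x) = 0.
have Zout r y : r \notin X' -> Z (e r * y).
  move=> nrX v; elim/last_ind: v y => [|v t IHv] y; first by rewrite eps_vgenM.
  move=> /sub_rcons[vX tX]; rewrite ders_rcons der_vgenM.
  by case: eqP nrX tX => [-> /negPf->//|_ _ _]; rewrite addr0 IHv.
have Zin r y : Z y -> Z (e r * y).
  move=> Zy v; elim/last_ind: v y Zy => [|v t IHv] y Zy; first by rewrite eps_vgenM.
  move=> /sub_rcons[vX tX]; rewrite ders_rcons der_vgenM (linD (ders_lin D v)) epsD.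
  rewrite IHv // ?add0r => [|w' w'X]; last first.
    rewrite -ders_rcons; apply: Zy => r'; rewrite mem_rcons inE => /orP[/eqP->//|].
    exact: w'X.
  case: ifP => _; last by rewrite (lin0 (ders_lin D v)) eps0.
  have [c ->] := ders_twist chi2 D t v y; rewrite epsZ eps_twist Zy ?mulr0 //.
  by move=> _ /mapP[r' /vX r'X ->]; rewrite rX.
move=> wX uX; suff: Z (mon u) by apply.
elim: u uX => //= r u IHu; rewrite negb_and => /orP[|uX]; first exact: Zout.
exact/Zin/IHu.
Qed.

Definition invs (x : A) := forall t, t \in X' -> der t x = 0.

Lemma invs_subspace : subspace invs.
Proof.
split=> [t _|a x y Cx Cy t tX]; first exact: lin0 (der_lin D t).
by rewrite der_lin Cx // Cy // scaler0 addr0.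
Qed.

Lemma ders_invsM c b u :
  {subset u <= X'} -> invs c -> ders u (c * b) = c * ders u b.
Proof.
move=> uX Cc; elim: u uX => // t u IHu uX /=.
rewrite -!/(ders _ _) IHu => [|r ru]; last by apply: uX; rewrite inE ru orbT.
by rewrite derM Cc ?mul0r ?addr0 // uX ?mem_head.
Qed.

Local Notation Y := {t : X | t \in X'}.

Definition dersY (w : seq Y) (x : A) := ders (map val w) x.

Definition filt n (x : A) := forall w : n.-tuple Y, dersY w x = 0.

Definition op n (a : n.-tuple Y -> K) (x : A) : A :=
  \sum_(w : n.-tuple Y) a w *: dersY w x.

Lemma valY_sub (w : seq Y) : {subset map val w <= X'}.
Proof. by move=> _ /mapP[t _ ->]; exact: valP. Qed.

Lemma dersY_lin w : linear (dersY w).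
Proof. exact: ders_lin. Qed.

Lemma op_lin n (a : n.-tuple Y -> K) : linear (op a).
Proof.
move=> c x y; rewrite /op scaler_sumr -big_split; apply: eq_bigr => w _.
by rewrite dersY_lin scalerDr !scalerA mulrC.
Qed.

Lemma filt_subspace n : subspace (filt n).
Proof.
split=> [w|a x y Fx Fy w]; first exact: lin0 (dersY_lin w).
by rewrite dersY_lin Fx Fy scaler0 addr0.
Qed.

Lemma filtS n x : filt n x -> filt n.+1 x.
Proof.
move=> Fx w; rewrite (tuple_eta w) /dersY /=.
have := Fx (behead_tuple w); rewrite /dersY /ders => ->.
exact: lin0 (der_lin D _).
Qed.

Lemma eps_lders u y : eps (foldr lder y u) = eps (ders (rev u) y).
Proof.
have der_lders t v z : der t (foldr lder z v) = foldr lder (der t z) v.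
  by elim: v => //= s v <-; rewrite (der_lder chi2).
elim: u y => //= t u IHu y; rewrite eps_lder der_lders IHu rev_cons.
by rewrite ders_rcons.
Qed.

(** A combination of the derivations of the subrack is determined by its
    composite with the counit, since it commutes with the left derivations,
    which separate points as well. *)
Lemma op_null n (a : n.-tuple Y -> K) :
  (forall x, eps (op a x) = 0) -> forall x, op a x = 0.
Proof.
move=> a0 x; apply: sep => u; rewrite -[u]revK -eps_lders.
suff -> : foldr lder (op a x) (rev u) = op a (foldr lder x (rev u)) by [].
elim: (rev u) => //= t v ->; rewrite (lin_sum (lder_lin D t)).
apply: eq_bigr => w _.
by rewrite (linZ (lder_lin D t)) /dersY (ders_lder chi2).
Qed.

(** Words of size more than n have no constant term after n derivations, and
    those with a letter outside X' neither; the other words are in the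
    subalgebra and in the step n.+1 of the filtration. *)
Lemma op_det n (a : n.-tuple Y -> K) :
  (forall b, subalg b -> filt n.+1 b -> eps (op a b) = 0) -> forall x, op a x = 0.
Proof.
move=> aB; apply: op_null; apply: mon_span => [|u].
  split=> [|c x y x0 y0]; first by rewrite (lin0 (op_lin a)) eps0.
  by rewrite op_lin eps_lin x0 y0 mulr0 addr0.
have [uX|uX] := boolP (all [in X'] u); last first.
  rewrite eps_sum big1 // => w _; rewrite epsZ (eps_ders_out _ uX) ?mulr0 //.
  exact: valY_sub.
have [un|nu] := leqP (size u) n.
  apply: aB => [|w]; first by apply: subalg_mon; exact/allP.
  by apply: ders_mon; rewrite size_map size_tuple ltnS.
rewrite eps_sum big1 // => w _; rewrite epsZ eps_ders_mon ?mulr0 //.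
by rewrite size_map size_tuple neq_ltn nu.
Qed.

Lemma der_op n (a : n.-tuple Y -> K) x : filt n.+1 x -> invs (op a x).
Proof.
move=> Fx t tX; rewrite (lin_sum (der_lin D t)) big1 // => w _.
rewrite (linZ (der_lin D t)); have := Fx (cons_tuple (Sub t tX) w).
by rewrite /dersY /= => ->; rewrite scaler0.
Qed.

Lemma subalg_op n (a : n.-tuple Y -> K) b : subalg b -> subalg (op a b).
Proof.
move=> Bb; apply: (subspace_sum _ subalg_subspace) => w _.
apply: (subspaceZ _ subalg_subspace); apply: subalg_ders Bb; exact: valY_sub.
Qed.

Lemma subalg_invs b : subalg b -> invs b -> b = eps b *: 1.
Proof.
move=> Bb Cb; apply: der_const => t; have [tX|tX] := boolP (t \in X').
  exact: Cb.
exact: der_subalg_out Bb.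
Qed.

(** The coaction of a relative Hopf module inside A is encoded by the
    stability under the derivations of the subrack; of the action of the
    subalgebra only the products with invariants matter. *)
Definition hopf_module (U : A -> Prop) :=
  [/\ subspace U, forall t x, t \in X' -> U x -> U (der t x)
    & forall c b, U c -> invs c -> subalg b -> U (c * b)].

Lemma hopf_ders U u x : hopf_module U -> {subset u <= X'} -> U x -> U (ders u x).
Proof.
case=> _ Ud _; elim: u => //= t u IHu uX Ux; apply: Ud; first exact/uX/mem_head.
by apply: IHu => // s su; apply: uX; rewrite inE su orbT.
Qed.

(** By op_det the combinations of derivations of order n form a space dual to
    the quotient of two steps of the filtration of the subalgebra.  With dual
    bases f_i and b_i, the map x |-> (f_i x)_i from the step n.+1 of U to
    r-tuples of invariants has the step n as kernel, and it is onto since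
    it maps the sum of the c_i b_i to (c_i)_i. *)
Lemma filt_step n : exists r, forall U k c, hopf_module U ->
  has_dim (fun x => U x /\ filt n x) k -> has_dim (fun x => U x /\ invs x) c ->
  has_dim (fun x => U x /\ filt n.+1 x) (k + r * c).
Proof.
have sB : subspace (fun x => subalg x /\ filt n.+1 x).
  have [[B0 BL] [F0 FL]] := (subalg_subspace, filt_subspace n.+1).
  by split=> [//|a x y [Bx Fx] [By Fy]]; split; [exact: BL|exact: FL].
have lphi (w : n.-tuple Y) : scalar (fun x => eps (dersY w x)).
  by move=> a x y; rewrite dersY_lin eps_lin.
have [r [b [a [Bb ab sepb]]]] := biorthogonal_system sB lphi.
have eps_op (c : n.-tuple Y -> K) x : eps (op c x) = \sum_w c w * eps (dersY w x).
  by rewrite eps_sum; apply: eq_bigr => w _; rewrite epsZ.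
have abE i j : eps (op (a i) (b j)) = (i == j)%:R by rewrite eps_op ab.
have op_const (c : n.-tuple Y -> K) x :
    subalg x -> filt n.+1 x -> op c x = eps (op c x) *: 1.
  by move=> Bx Fx; apply: subalg_invs; [exact: subalg_op|exact: der_op].
(* Each derivation of order n is the combination of the op (a j) dictated by
   its values on the b j. *)
have dersYE (w : n.-tuple Y) x :
    dersY w x = \sum_j eps (dersY w (b j)) *: op (a j) x.
  pose a' (v : n.-tuple Y) := (v == w)%:R - \sum_j eps (dersY w (b j)) * a j v.
  have op_a' y : op a' y = dersY w y - \sum_j eps (dersY w (b j)) *: op (a j) y.
    rewrite /op; under eq_bigr => v _ do rewrite scalerBl.
    rewrite sumrB (bigD1 w) //= eqxx scale1r big1 ?addr0 => [|v /negPf->]; last first.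
      by rewrite scale0r.
    congr (_ - _); under eq_bigr => v _ do rewrite scaler_suml.
    rewrite exchange_big; apply: eq_bigr => j _; rewrite scaler_sumr.
    by apply: eq_bigr => v _; rewrite scalerA.
  apply/eqP; rewrite -subr_eq0 -op_a'; apply/eqP/op_det => y By Fy.
  pose y' := y - \sum_j eps (op (a j) y) *: b j.
  have y'B : subalg y' /\ filt n.+1 y'.
    rewrite /y' -scaleN1r addrC; apply: sB.2 => //.
    apply: (subspace_sum _ sB) => j _; exact: (subspaceZ _ sB (Bb j)).
  have phi_y' (c : n.-tuple Y -> K) : eps (op c y') =
      eps (op c y) - \sum_j eps (op (a j) y) * eps (op c (b j)).
    rewrite (linB (op_lin c)) (lin_sum (op_lin c)) -scaleN1r epsD epsZ mulN1r.
    rewrite (eps_sum D (fun j => op c (eps (op (a j) y) *: b j))).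
    congr (_ - _); apply: eq_bigr => j _.
    by rewrite (linZ (op_lin c)) epsZ.
  have /(_ w) : forall w : n.-tuple Y, eps (dersY w y') = 0.
    apply: sepb => // i; rewrite -eps_op phi_y' (bigD1 i) //= abE eqxx mulr1.
    rewrite big1 ?addr0 ?subrr // => j ji.
    by rewrite abE eq_sym (negPf ji) mulr0.
  have dersY_op z : dersY w z = op (fun v : n.-tuple Y => (v == w)%:R) z.
    rewrite /op (bigD1 w) //= eqxx scale1r big1 ?addr0 // => v /negPf->.
    by rewrite scale0r.
  have -> // : eps (dersY w y') = eps (op a' y).
  rewrite op_a' [dersY w y']dersY_op phi_y' -dersY_op -scaleN1r epsD epsZ mulN1r.
  rewrite (eps_sum D (fun j => eps (dersY w (b j)) *: op (a j) y)).
  by congr (_ - _); apply: eq_bigr => j _; rewrite epsZ -dersY_op mulrC.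
exists r => U k c hU dk dc; have [sU Ud Um] := hU.
pose f x : {ffun 'I_r -> A} := [ffun i => op (a i) x].
have lf : linear f.
  by move=> d x y; apply/ffunP => i; rewrite !ffunE op_lin.
have sUF : subspace (fun x => U x /\ filt n.+1 x).
  have [[U0 UL] [F0 FL]] := (sU, filt_subspace n.+1).
  by split=> [//|d x y [Ux Fx] [Uy Fy]]; split; [exact: UL|exact: FL].
apply: (has_dim_rank lf sUF).
  apply: has_dim_ext dk => x; split=> [[Ux Fx]|[[Ux _] fx]].
    split; first by split=> //; exact: filtS.
    apply/ffunP => i; rewrite !ffunE /op big1 // => w _.
    by rewrite Fx scaler0.
  split=> // w; rewrite dersYE big1 // => j _.
  have := congr1 (fun g : {ffun 'I_r -> A} => g j) fx; rewrite !ffunE => ->.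
  by rewrite scaler0.
have sUC : subspace (fun x => U x /\ invs x).
  have [[U0 UL] [C0 CL]] := (sU, invs_subspace).
  by split=> [//|d x y [Ux Fx] [Uy Fy]]; split; [exact: UL|exact: CL].
have := has_dim_ffun 'I_r sUC dc; rewrite card_ord; apply: has_dim_ext => y.
split=> [yUC|[x [Ux Fx] <-] i]; last first.
  rewrite ffunE; split; last exact: der_op.
  apply: subspace_sum => // w _; apply: subspaceZ => //.
  by apply: hopf_ders => //; exact: valY_sub.
exists (\sum_i y i * b i).
  split.
    apply: subspace_sum => // i _.
    by apply: Um; [exact: (yUC i).1|exact: (yUC i).2|exact: (Bb i).1].
  apply: (subspace_sum _ (filt_subspace _)) => i _ w; rewrite /dersY ders_invsM //.
  - by rewrite -[ders _ _]/(dersY w (b i)) (Bb i).2 mulr0.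
  - exact: valY_sub.
  - exact: (yUC i).2.
apply/ffunP => j; rewrite ffunE (lin_sum (op_lin (a j))).
have opM i : op (a j) (y i * b i) = y i * op (a j) (b i).
  rewrite (lin_sum (mulr_linr D (y i))); apply: eq_bigr => w _.
  rewrite -(mulZr D); congr (_ *: _); apply: ders_invsM; first exact: valY_sub.
  exact: (yUC i).2.
have opb i : op (a j) (b i) = (j == i)%:R *: 1.
  by have [Bi Fi] := Bb i; rewrite op_const // abE.
rewrite (bigD1 j) //= big1 ?addr0 => [|i ij]; rewrite opM opb.
  by rewrite eqxx scale1r mulr1.
by rewrite eq_sym (negPf ij) scale0r mulr0.
Qed.

(** Summing the steps of the filtration, which are finitely many as the
    derivations are nilpotent. *)
Lemma hopf_module_dim : exists M, forall U c, hopf_module U ->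
  has_dim (fun x => U x /\ invs x) c -> has_dim U (M * c).
Proof.
have [r rP] := choice filt_step.
have [n nP] := ders_nilp_unif.
exists (\sum_(i < n) r i)%N => U c hU dc.
have dimF j : has_dim (fun x => U x /\ filt j x) (\sum_(i < j) r i * c).
  elim: j => [|j IHj]; last by rewrite big_ord_recr; exact: rP.
  rewrite big_ord0; apply: has_dim_ext (has_dim0 A) => x; split=> [->|[_ Fx]].
    by have [[U0 _] _ _] := hU; split=> //; case: (filt_subspace 0).
  exact: (Fx [tuple]).
rewrite big_distrl; apply: has_dim_ext (dimF n) => x; split=> [[]//|Ux].
by split=> // w; apply: nP; rewrite size_map size_tuple.
Qed.

Definition hinvs g (x : A) := invs x /\ homog g x = x.

Lemma hinvs_subspace g : subspace (hinvs g).
Proof.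
split=> [|a x y [Cx hx] [Cy hy]].
  by split; [case: invs_subspace|rewrite (lin0 (homog_lin D g))].
by split; [exact: invs_subspace.2|rewrite homog_lin hx hy].
Qed.

(** The functionals of L_t^m are those of D_t^m, since both sides agree on a
    single derivation and commute; and D_t^m is 0. *)
Lemma iter_lder0 t m x : t |> t = t -> (1 < m)%N ->
  m.-primitive_root (chi t t) -> iter m (lder t) x = 0.
Proof.
move=> tt m1 qm; apply: sep => u.
have -> : ders u (iter m (lder t) x) = iter m (lder t) (ders u x).
  by elim: (m) => //= k IHk; rewrite (ders_lder chi2) IHk.
have iterE (f : X -> A -> A) y : iter m (f t) y = foldr f y (nseq m t).
  by elim: (m) => //= k ->.
rewrite iterE eps_lders rev_nseq.
by rewrite -[ders _ _]iterE (der_pow0 chi2) // eps0.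
Qed.

(** For t outside the subrack, left multiplication by t and lder t commute with
    the derivations of the subrack, and they satisfy the relation of the
    q-Weyl algebra.  If m = 1, that relation is of no use because then d^m = 0
    fails, but lperm t is trivial. *)
Lemma hinvs_dim_mul t m g k l :
  t |> t = t -> t \notin X' -> m.-primitive_root (chi t t) ->
  (lperm t ^+ m)%g = 1%g ->
  has_dim (hinvs g) k -> has_dim (hinvs (g * lperm t)%g) l -> k = l.
Proof.
move=> tt tX qm pm.
have [m1|m1] := leqP m 1.
  have m0 : m = 1%N by apply/eqP; rewrite eqn_leq m1 (prim_order_gt0 qm).
  move: pm; rewrite m0 expg1 => ->; rewrite mulg1; exact: has_dim_uniq.
apply: (qweyl_has_dim qm m1 (x := *%R (e t)) (d := lder t)
  dimA _ _ hinvs_subspace _ _ _ _ pm).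
- exact: vgen_linr.
- exact: lder_lin.
- move=> h v [Cv hv]; split=> [s sX|]; last by rewrite homog_vgenM hv.
  rewrite der_vgenM Cv // mulr0 add0r; case: eqP tX => // ->.
  by rewrite sX.
- move=> h v [Cv hv]; split=> [s sX|].
    by rewrite (der_lder chi2) Cv // (lin0 (lder_lin D t)).
  by rewrite -homog_lder hv.
- by move=> h v _; rewrite -{1}tt lder_vgenM tt eqxx.
- by move=> h v _; exact: iter_lder0.
Qed.

(** A component of the invariants can be multiplied by any t outside of the
    subrack without changing its dimension, and these t lead from the identity
    to all of Inn X. *)
Lemma invs_equidim m :
  (forall t : X, t |> t = t) -> (forall t, m.-primitive_root (chi t t)) ->
  (forall t : X, (lperm t ^+ m)%g = 1%g) ->
  <<[set lperm t | t in ~: X']>>%g = Inn X :> {set {perm X}} ->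
  exists k N', [/\ forall g, g \in Inn X -> has_dim (hinvs g) k,
    has_dim subalg N' & N = (#|Inn X| * k * N')%N].
Proof.
move=> idX qm pm genX.
have [k1 dk1] : exists k, has_dim (hinvs 1%g) k.
  exact: has_dim_sub dimA (hinvs_subspace 1%g) _.
have dk g : g \in Inn X -> has_dim (hinvs g) k1.
  rewrite -genX => /gen_prodgP[n [c cX ->]]; elim: n c cX => [|n IHn] c cX.
    by rewrite big_ord0.
  rewrite big_ord_recr /=; have /imsetP[t tX ->] := cX ord_max.
  set h := (\prod_(i < n) _)%g.
  have [l dl] : exists l, has_dim (hinvs (h * lperm t)%g) l.
    exact: has_dim_sub dimA (hinvs_subspace _) _.
  suff -> : k1 = l by [].
  have tX' : t \notin X' by rewrite inE in tX.
  apply: (hinvs_dim_mul (idX t) tX' (qm t) (pm t) _ dl).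
  exact: IHn.
have dC : has_dim invs (#|Inn X| * k1)%N.
  apply: (has_dim_graded (pr := homog)) => //.
  - exact: invs_subspace.
  - exact: homog_lin.
  - move=> g x Cx t tX; rewrite -[g](mulKVg (lperm t)) homog_der // Cx //.
    exact: lin0 (homog_lin D _).
  - exact: homog_homog.
  - by move=> x _; exact: homog_sum.
have [M MP] := hopf_module_dim.
have dB : has_dim subalg (M * 1)%N.
  apply: MP.
    split; first exact: subalg_subspace.
      by move=> t x; exact: subalg_der.
    by move=> c b Bc _; exact: subalg_mul.
  exists (fun=> 1); split=> [_|c c0 i|x [Bx Cx]].
  - by split; [exact: subalg_one|move=> t _; exact: der_one].
  - move: c0; rewrite big_ord1 => /(congr1 eps); rewrite epsZ eps_one mulr1 eps0.
    by move=> c0; rewrite [i]ord1.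
  - by exists (fun=> eps x); rewrite big_ord1; exact: subalg_invs.
exists k1, M; split; [exact: dk|by rewrite muln1 in dB|].
have dA : has_dim (fun _ : A => True) (M * (#|Inn X| * k1))%N.
  by apply: MP => //; apply: has_dim_ext dC => x; split=> [|[]].
by rewrite mulnC; exact: has_dim_uniq dimA dA.
Qed.

End Factorization.

(** * A Nichols algebra over the tetrahedral quandle *)

(** The pair (a, b) stands for the element a + b w of the field with four
    elements, where w^2 = w + 1, and the operation is t |> s = w s + w^2 t.
    This is the quandle of a conjugacy class of 3-cycles in A_4. *)
Definition tetra : Type := (bool * bool)%type.
HB.instance Definition _ := Finite.on tetra.

Definition tetra_op (t s : tetra) : tetra :=
  (s.2 (+) (t.1 (+) t.2), s.1 (+) s.2 (+) t.1).

Lemma tetra_opD t1 t2 t3 : tetra_op t1 (tetra_op t2 t3) =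
  tetra_op (tetra_op t1 t2) (tetra_op t1 t3).
Proof. by case: t1 t2 t3 => [[] []] [[] []] [[] []]. Qed.

Lemma tetra_op_bij t : bijective (tetra_op t).
Proof.
by exists (fun s => tetra_op t (tetra_op t s)); case: t => [[] []] [[] []].
Qed.

HB.instance Definition _ := isRack.Build tetra tetra_opD tetra_op_bij.

Lemma tetra_opid (t : tetra) : t |> t = t.
Proof. by case: t => [[] []]. Qed.

HB.instance Definition _ := isQuandle.Build tetra tetra_opid.

Definition tetras : seq tetra :=
  [:: (false, false); (false, true); (true, false); (true, true)].

Lemma mem_tetras (t : tetra) : t \in tetras. Proof. by case: t => [[] []]. Qed.

Lemma tetra_faithful : faithful_rack tetra.
Proof.
move=> t s /permP ts; have := ts (false, false); rewrite !permE.
by case: t {ts} => [[] []]; case: s => [[] []].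
Qed.

Lemma tetra_indecomposable : indecomposable tetra.
Proof.
have lI (t : tetra) : lperm t \in Inn tetra by apply/mem_gen/imset_f.
apply/imsetP; exists (false, false) => //; apply/setP => s; rewrite inE; apply/esym.
have [t ts] : exists t : tetra, t |> (false, false) = s.
  exists (s.2, s.1 (+) s.2).
  by case: s => [[] []].
by apply/orbitP; exists (lperm t) => //; rewrite /= /aperm permE.
Qed.

Lemma tetra_deg : rack_deg tetra 3.
Proof.
move=> t; have t3 : (lperm t ^+ 3)%g = 1%g.
  apply/permP => s; rewrite !expgS expg0 mulg1 !permM perm1 !permE.
  by case: t => [[] []]; case: s => [[] []].
apply: nt_prime_order => //; apply/eqP => /permP t1.
have := t1 (false, false); have := t1 (true, true).
by rewrite !permE; case: t {t3 t1} => [[] []].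
Qed.

Definition one_cocycle (_ _ : tetra) : 'F_2 := 1.

Lemma one_cocycleP : cocycle2 one_cocycle.
Proof. by split=> *; rewrite /one_cocycle ?oner_eq0. Qed.

Section Tetrahedron.
Local Notation chi := one_cocycle.
Local Notation TV := {malg 'F_2[word tetra]}.
Local Notation wm := (@wmon 'F_2 tetra).
Local Notation D := (free_deriv chi).
Local Notation E := (nichols_deriv one_cocycleP).
Local Notation proj := (@nproj 'F_2 tetra chi).

(** Over the field with two elements a list of words stands for the sum of
    its entries, so that derivations can be computed on lists. *)
Definition wsum (l : seq (seq tetra)) : TV := \sum_(w <- l) wm w.

Lemma wsum_cons w l : wsum (w :: l) = wm w + wsum l.
Proof. exact: big_cons. Qed.

Lemma wsum_cat l1 l2 : wsum (l1 ++ l2) = wsum l1 + wsum l2.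
Proof. exact: big_cat. Qed.

Lemma addTT (x : TV) : x + x = 0.
Proof.
have F2 : (1 + 1 : 'F_2) = 0 by apply/val_inj.
by rewrite -[x]scale1r -scalerDl F2 scale0r.
Qed.

Fixpoint word_der (t : tetra) (w : seq tetra) : seq (seq tetra) :=
  if w is s :: w' then
    [seq s :: v | v <- word_der t w'] ++
    (if s == t then [:: [seq tetra_op t r | r <- w']] else [::])
  else [::].

Lemma word_derE t w : rder chi t (wm w) = wsum (word_der t w).
Proof.
elim: w => [|s w IHw]; first by rewrite wmon_nil rder1 /wsum big_nil.
rewrite wmon_cons rder_genM IHw wsum_cat; apply: congr2.
  rewrite /wsum mulr_sumr big_map; apply: eq_bigr => v _.
  by rewrite -wmon_cons.
case: ifP => _; last by rewrite /wsum big_nil.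
rewrite gact_wmon big1 ?scale1r // /wsum big_seq1.
by [].
Qed.

(** Equal words cancel, as 2 = 0. *)
Definition toggle w (l : seq (seq tetra)) := if w \in l then rem w l else w :: l.

Definition list_der t (l : seq (seq tetra)) : seq (seq tetra) :=
  foldr toggle [::] (flatten [seq word_der t w | w <- l]).

(** The fuel n must exceed the length of all words in l: for n = 0 only the
    empty list is accepted. *)
Fixpoint nullb n (l : seq (seq tetra)) : bool :=
  if l is [::] then true else
  if n is n'.+1 then
    ~~ odd (count_mem [::] l) && all (fun t => nullb n' (list_der t l)) tetras
  else false.

Fixpoint sublists (T : Type) (l : seq T) : seq (seq T) :=
  if l is x :: l' then let r := sublists l' in r ++ [seq x :: y | y <- r]
  else [:: [::]].

Definition word_deg_values (w : seq tetra) :=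
  [seq foldr tetra_op x w | x <- tetras].

Definition tau0 : tetra := (false, false).
Definition tau1 : tetra := (false, true).
Definition tau2 : tetra := (true, false).
Definition tau3 : tetra := (true, true).

(** The words that are not the leading word of a relation, for a suitable
    order.  In degrees 0 to 6 there are 1, 4, 8, 10, 8, 4 and 1 of them. *)
Definition normal_words : seq (seq tetra) :=
  [seq u ++ v | u <- [:: [::]; [:: tau2]; [:: tau3]; [:: tau1; tau2];
                         [:: tau3; tau2]; [:: tau3; tau1; tau2]],
                v <- [:: [::]; [:: tau0]; [:: tau1]; [:: tau1; tau0];
                         [:: tau0; tau1]; [:: tau0; tau1; tau0]]].

(** Only normal words of the same length and degree can occur in the normal
    form of t :: v, and they are few enough for trying all their sums.  The
    fuel 8 is enough as normal words have length at most 6. *)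
Definition reducible t v :=
  has (fun l => nullb 8 ((t :: v) :: l))
    (sublists [seq u <- normal_words |
       (size u == (size v).+1) &&
       (word_deg_values u == word_deg_values (t :: v))]).

Lemma normal_words_closed : all (fun t => all (reducible t) normal_words) tetras.
Proof. by vm_compute. Qed.

Lemma wsum_toggle w l : wsum (toggle w l) = wm w + wsum l.
Proof.
rewrite /toggle; case: ifP => [wl|_]; last exact: wsum_cons.
by rewrite [in RHS]/wsum (perm_big _ (perm_to_rem wl)) big_cons addrA addTT add0r.
Qed.

Lemma list_derE t l : rder chi t (wsum l) = wsum (list_der t l).
Proof.
have -> : wsum (list_der t l) = wsum (flatten [seq word_der t w | w <- l]).
  rewrite /list_der; elim: (flatten _) => //= w l' IHl.
  by rewrite wsum_toggle wsum_cons IHl.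
elim: l => [|w l IHl]; first by rewrite /wsum big_nil (lin0 (rder_lin chi t)).
by rewrite wsum_cons (linD (rder_lin chi t)) IHl word_derE -wsum_cat.
Qed.

Lemma counit_wsum l : counit (wsum l) = (odd (count_mem [::] l))%:R.
Proof.
elim: l => [|w l IHl]; first by rewrite /wsum big_nil /counit mcoeff0.
rewrite wsum_cons /counit mcoeffD -!/(counit _) IHl counit_wmon /= oddD.
by case: (w == [::]); case: (odd _); apply/val_inj.
Qed.

Lemma ders_wsum u l : ders D u (wsum l) = wsum (foldr list_der l u).
Proof. by elim: u => //= t u ->; exact: list_derE. Qed.

Lemma nullbP n l : nullb n l -> null D (wsum l).
Proof.
elim: n l => [|n IHn] [|w l] //.
- by move=> _; rewrite /wsum big_nil; case: (null_subspace D).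
- by move=> _; rewrite /wsum big_nil; case: (null_subspace D).
move=> /andP[ev /allP dl]; apply: nullP => [|t].
  by rewrite [eps _ _]counit_wsum (negPf ev).
by rewrite [der _ _ _]list_derE; apply: IHn; exact/dl/mem_tetras.
Qed.

Definition in_span (L : seq (seq tetra)) (b : nichols chi) :=
  exists c : 'I_(size L) -> 'F_2, b = \sum_i c i *: proj (wm (nth [::] L i)).

Lemma in_span_subspace L : subspace (in_span L).
Proof.
split=> [|a _ _ [c ->] [d ->]].
  by exists (fun=> 0); rewrite big1 // => i _; rewrite scale0r.
exists (fun i => a * c i + d i); rewrite scaler_sumr -big_split.
by apply: eq_bigr => i _; rewrite scalerDl scalerA.
Qed.

Lemma mem_in_span L w : w \in L -> in_span L (proj (wm w)).
Proof.
move=> wL; pose i0 := Ordinal (etrans (index_mem w L) wL).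
exists (fun i => (i == i0)%:R); rewrite (bigD1 i0) //= eqxx scale1r nth_index //.
by rewrite big1 ?addr0 // => i /negPf->; rewrite scale0r.
Qed.

Lemma in_span_wsum L l : all [in L] l -> in_span L (proj (wsum l)).
Proof.
elim: l => [_|w l IHl /andP[wL lL]].
  rewrite /wsum big_nil (lin0 (nproj_lin chi)); exact: (in_span_subspace L).1.
rewrite wsum_cons (linD (nproj_lin chi)).
by apply: (subspaceD (in_span_subspace L)); [exact: mem_in_span|exact: IHl].
Qed.

Lemma mem_sublists (T : eqType) (l r : seq T) : l \in sublists r -> {subset l <= r}.
Proof.
elim: r l => [|x r IHr] l /=; first by rewrite inE => /eqP->.
rewrite mem_cat => /orP[/IHr lr y /lr|/mapP[l' /IHr lr ->] y]; rewrite !inE.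
  by move=> ->; rewrite orbT.
by case/orP => [->//|/lr->]; rewrite orbT.
Qed.

(** The span of the normal words contains 1 and is stable under left
    multiplication by letters. *)
Lemma normal_words_span b : in_span normal_words b.
Proof.
have sS := in_span_subspace normal_words.
elim/(@word_ind _ _ _ _ E): b => // [|t _ [c ->]].
  exact: (mem_in_span (w := [::])).
rewrite mulr_sumr; apply: subspace_sum => // i _.
rewrite -(mulZr E); apply: subspaceZ => //; set v := nth _ _ _.
have vN : v \in normal_words by exact: mem_nth.
have /hasP[l lS ln] : reducible t v.
  by have /allP/(_ t (mem_tetras t))/allP/(_ v vN) := normal_words_closed.
have -> : vgen E t * proj (wm v) = proj (wsum l); last first.
  apply: in_span_wsum; apply/allP => w /(mem_sublists lS).
  by rewrite mem_filter => /andP[].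
rewrite [vgen E t * _](_ : _ = proj (wm (t :: v))); last first.
  by rewrite wmon_cons nproj_mul.
apply/(nproj_null one_cocycleP).
have -> : wm (t :: v) - wsum l = wsum ((t :: v) :: l).
  rewrite wsum_cons; congr (_ + _); apply/eqP.
  by rewrite -subr_eq0 -opprD addTT oppr0.
exact: nullbP ln.
Qed.

Lemma nichols_tetra_dim : exists N, has_dim (fun _ : nichols chi => True) N.
Proof.
have [||k _ dk] := has_dim_span (U := fun=> True)
  (b := fun i : 'I_(size normal_words) => proj (wm (nth [::] normal_words i))).
- by [].
- by move=> b _; exact: normal_words_span.
by exists k.
Qed.

Lemma word_degE (w : word tetra) x : word_deg w x = foldr tetra_op x w.
Proof.
elim: w => [|t w IHw]; first exact: perm1.
by rewrite [word_deg _]/= permM IHw permE.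
Qed.

(** The degree is a double transposition of A_4.  The homogeneous projection
    kills all normal words but the two in F. *)
Lemma ncomp_small : exists2 k, (k <= 2)%N &
  has_dim (ncomp chi (word_deg [:: tau0; tau1; tau0])) k.
Proof.
set h := word_deg _; pose F := [:: [:: tau0; tau1; tau0]; [:: tau3; tau1; tau2]].
apply: (has_dim_span (b := fun i : 'I_(size F) => proj (wm (nth [::] F i)))).
  exact: ncomp_subspace one_cocycleP h.
move=> b /(ncompP one_cocycleP) <-; have [c ->] := normal_words_span b.
have sF := in_span_subspace F.
rewrite (lin_sum (homog_lin E h)); apply: (subspace_sum _ sF) => i _.
rewrite (linZ (homog_lin E h)); apply: (subspaceZ _ sF); set v := nth _ _ _.
rewrite nichols_homog [homog D h _]free_homog_wmon; case: eqP => [vh|_]; last first.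
  by rewrite (lin0 (nproj_lin chi)); case: sF.
apply: mem_in_span; have : v \in normal_words by exact: mem_nth.
have /allP aF : all (fun w => (word_deg_values w ==
    word_deg_values [:: tau0; tau1; tau0]) ==> (w \in F)) normal_words.
  by vm_compute.
move=> /aF/implyP; apply; apply/eqP/eq_map => x.
by rewrite -!word_degE vh.
Qed.

Lemma ncomp_large k : has_dim (ncomp chi 1%g) k -> (3 <= k)%N.
Proof.
case=> b [_ _ bs].
(* The derivations by the words U send the words W to the identity matrix. *)
pose W := [:: [::]; [:: tau3; tau1; tau0]; [:: tau1; tau2; tau0]].
pose U := [:: [::]; [:: tau2; tau1; tau3]; [:: tau0; tau1; tau2]].
pose e (i : 'I_3) := proj (wm (nth [::] W i)).
apply: (free_le_span (b := b) (e := e)) => [i|c c0 i].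
  apply: bs; apply/(ncompP one_cocycleP); rewrite nichols_homog; congr proj.
  rewrite [LHS]free_homog_wmon; case: eqP => // -[]; apply/permP => x.
  rewrite perm1 word_degE; case: i => -[|[|[]]] //= _.
  - by case: x => [[] []].
  - by case: x => [[] []].
have := congr1 (fun x => eps E (ders E (nth [::] U i) x)) c0.
rewrite (lin0 (ders_lin E _)) eps0 (lin_sum (ders_lin E _)).
rewrite eps_sum.
have pairE j : eps E (ders E (nth [::] U i) (c j *: proj (wm (nth [::] W j)))) =
    c j * (i == j)%:R.
  rewrite (linZ (ders_lin E _)) epsZ nichols_ders nichols_eps; congr (_ * _).
  have -> : wm (nth [::] W j) = wsum [:: nth [::] W j] by rewrite /wsum big_seq1.
  rewrite ders_wsum [LHS]counit_wsum.
  by case: i => -[|[|[]]] // i3; case: j => -[|[|[]]] // j3; rewrite -val_eqE.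
rewrite (eq_bigr (fun j => c j * (i == j)%:R)) => [|j _]; last exact: pairE.
rewrite (bigD1 i) //= eqxx mulr1 big1 ?addr0 // => j ji.
by rewrite eq_sym (negPf ji) mulr0.
Qed.

End Tetrahedron.

(** * The divisibility theorem *)

(** The empty subrack is allowed: its invariants are the whole algebra. *)
Lemma nichols_equidim (K : fieldType) (X : finQuandleType) (chi : X -> X -> K)
    (chi2 : cocycle2 chi) (N d m : nat) (X' : {set X}) :
  has_dim (fun _ : nichols chi => True) N ->
  rack_deg X d -> cocycle_ord chi m -> (d %| m)%N -> subrack X' ->
  <<[set lperm t | t in ~: X']>>%g = Inn X :> {set {perm X}} ->
  exists k N', [/\ forall g, g \in Inn X ->
      has_dim (fun b => invs (nichols_deriv chi2) X' b /\ ncomp chi g b) k,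
    has_dim (nsub chi X') N' & N = (#|Inn X| * k * N')%N].
Proof.
move=> dimB degX ordq dm subX' genX.
have pm (t : X) : (lperm t ^+ m)%g = 1%g.
  by have /dvdnP[c ->] := dm; rewrite mulnC expgM -(degX t) expg_order expg1n.
have [k [N' [dk dB NE]]] := invs_equidim chi2 (nichols_sep (chi2 := chi2))
  dimB subX' (@rop_id X) ordq pm genX.
exists k, N'; split=> // g /dk; apply: has_dim_ext => b.
by rewrite (ncompP chi2).
Qed.

Theorem theorem2 :
  (forall (K : fieldType) (X : finQuandleType) (chi : X -> X -> K)
          (N d m : nat),
     faithful_rack X -> indecomposable X -> cocycle2 chi ->
     has_dim (fun _ : nichols chi => True) N ->
     rack_deg X d -> cocycle_ord chi m -> (d %| m)%N ->
     ((exists k : nat, forall g : {perm X}, g \in Inn X ->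
         has_dim (ncomp chi g) k)
      /\ (#|Inn X| %| N)%N)
     /\
     (forall X' : {set X},
        subrack X' -> X' != set0 -> X' \proper [set: X] ->
        <<[set lperm t | t in ~: X']>>%g = Inn X :> {set {perm X}} ->
        exists N' : nat,
          has_dim (nsub chi X') N' /\ (#|Inn X| * N' %| N)%N))
  /\
  (exists (K : fieldType) (X : finQuandleType) (chi : X -> X -> K)
          (N d m : nat),
     faithful_rack X /\ indecomposable X /\ cocycle2 chi /\
     has_dim (fun _ : nichols chi => True) N /\
     rack_deg X d /\ cocycle_ord chi m /\ ~ (d %| m)%N /\
     exists (g h : {perm X}) (k l : nat),
       g \in Inn X /\ h \in Inn X /\
       has_dim (ncomp chi g) k /\ has_dim (ncomp chi h) l /\ k <> l).
Proof.
split.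
  move=> K X chi N d m _ _ chi2 dimB degX ordq dm; split=> [|X' subX' _ _ genX].
    have sub0 : subrack (set0 : {set X}) by move=> t; rewrite inE.
    have gen0 : <<[set lperm t | t in ~: (set0 : {set X})]>>%g = Inn X.
      by congr <<_>>%g; apply/setP => p; apply/imsetP/imsetP => -[t _ ->];
        exists t; rewrite ?inE.
    have [k [N' [dk _ ->]]] := nichols_equidim chi2 dimB degX ordq dm sub0 gen0.
    split; last by rewrite -mulnA dvdn_mulr.
    exists k => g /dk; apply: has_dim_ext => b; split=> [[]//|gb].
    by split=> // t; rewrite inE.
  have [k [N' [_ dB ->]]] := nichols_equidim chi2 dimB degX ordq dm subX' genX.
  by exists N'; split=> //; rewrite mulnAC dvdn_mulr.
have [N dimB] := nichols_tetra_dim; have [l l2 dl] := ncomp_small.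
have hX : word_deg [:: tau0; tau1; tau0] \in Inn tetra.
  by rewrite /= mul1g !groupM // mem_gen // imset_f.
have [k dk] : exists k, has_dim (ncomp one_cocycle 1%g) k.
  exact: has_dim_sub dimB (ncomp_subspace one_cocycleP 1%g) _.
exists 'F_2, tetra, one_cocycle, N, 3%N, 1%N; do !split=> //.
- exact: tetra_faithful.
- exact: tetra_indecomposable.
- exact: tetra_deg.
- move=> t; apply/andP; split=> //; apply/forallP => i.
  by rewrite ord1 unity_rootE expr1 eqxx.
exists 1%g, (word_deg [:: tau0; tau1; tau0]), k, l; do !split=> //.
by move=> kl; have := leq_trans (ncomp_large dk) _; rewrite kl => /(_ _ l2).
Qed.
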